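(* Let $\mathbf{f}_1(t),\dots,\mathbf{f}_n(t)\in\mathbb{Z}[t]^m$ and for $t\in\mathbb{N}$ let $\Lambda_t=\operatorname{Span}_{\mathbb{Z}}\{\mathbf{f}_1(t),\dots,\mathbf{f}_n(t)\}$. Then there exist parametric vectors $\mathbf{g}_1(t),\dots,\mathbf{g}_n(t)$, all of whose coordinates are EQP functions, which form an eventually LLL-reduced basis of $\Lambda_t$ (i.e. for all sufficiently large $t$ they form a basis of $\Lambda_t$, and the basis is eventually LLL-reduced in the sense below).
   Context: A function $g:\mathbb{N}\to\mathbb{Q}$ is EQP if there exist $M\in\mathbb{N}$ and $g_0,\dots,g_{M-1}\in\mathbb{Q}[t]$ with $g(t)=g_r(t)$ for all sufficiently large $t\equiv r\pmod M$. For parametric vectors $\mathbf{h}_1,\dots,\mathbf{h}_n\in\mathbb{Z}[t]^m$ linearly independent over $\mathbb{Q}(t)$, the (non-normalized) Gram–Schmidt vectors over $\mathbb{Q}(t)$ are $\mathbf{h}_1^*=\mathbf{h}_1$, $\mathbf{h}_i^*=\mathbf{h}_i-\sum_{j<i}\rho_{i,j}\mathbf{h}_j^*$ with $\rho_{i,j}=\langle\mathbf{h}_i,\mathbf{h}_j^*\rangle/\langle\mathbf{h}_j^*,\mathbf{h}_j^*\rangle$ (standard dot product). Fix $1/4<\delta<1$ (usually $\delta=3/4$). Such a list is eventually LLL-reduced with factor $\delta$ if for all sufficiently large $t$: $|\rho_{i,j}(t)|\le 1/2$ for $1\le j<i\le n$, and $\|\mathbf{h}_i^*(t)\|^2/\|\mathbf{h}_{i-1}^*(t)\|^2+\rho_{i,i-1}(t)^2\ge\delta$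 for $2\le i\le n$. A list of parametric vectors with EQP coordinates, all eventually $M$-periodic, is eventually LLL-reduced if for every $r\in\{0,\dots,M-1\}$ the list $\mathbf{h}_{i,r}(t)=\mathbf{h}_i(Mt+r)$ (which lies in $\mathbb{Z}[t]^m$ for large $t$) is eventually LLL-reduced in the previous sense.
   Formalization: The vectors f_1(t),…,f_n(t) are additionally assumed linearly independent over Q(t); otherwise Λ_t has rank less than n for large t and no n vectors can form a basis (e.g. m=1, n=2, f_1=f_2=t). *)

(* Defs.v *)
From HB Require Import structures.
From mathcomp Require Import all_boot all_order all_algebra.
From mathcomp Require Import boolp reals.

Set Implicit Arguments.
Unset Strict Implicit.
Unset Printing Implicit Defensive.

Import Order.TTheory GRing.Theory Num.Theory.
Local Open Scope ring_scope.

Definition eventually (P : nat -> Prop) : Prop :=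
  exists N : nat, forall t : nat, (N <= t)%N -> P t.

(* [0 < M] is needed: there are no residue classes below 0. *)
Definition EQP_mod (M : nat) (g : nat -> rat) : Prop :=
  (0 < M)%N /\
  exists p : 'I_M -> {poly rat},
    eventually (fun t => forall r : 'I_M,
      t = r %[mod M] -> g t = (p r).[t%:R]).

Definition EQP (g : nat -> rat) : Prop := exists M : nat, EQP_mod M g.

Section GramSchmidt.
Variables (F : fieldType) (m : nat).

Definition dotv (u v : 'rV[F]_m) : F := \sum_(k < m) u 0 k * v 0 k.

Definition gs_step (us : seq 'rV[F]_m) (v : 'rV[F]_m) : seq 'rV[F]_m :=
  rcons us (v - \sum_(u <- us) (dotv v u / dotv u u) *: u).

Definition gs_seq (vs : seq 'rV[F]_m) : seq 'rV[F]_m := foldl gs_step [::] vs.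

(* The vectors are the rows of the matrix; see [row_gram_schmidt]. *)
Definition gram_schmidt n (A : 'M[F]_(n, m)) : 'M[F]_(n, m) :=
  \matrix_(i < n) nth 0 (gs_seq [seq row j A | j <- enum 'I_n]) i.

Definition gs_coef n (A : 'M[F]_(n, m)) (i j : 'I_n) : F :=
  dotv (row i A) (row j (gram_schmidt A))
    / dotv (row j (gram_schmidt A)) (row j (gram_schmidt A)).

Lemma gs_seq_rcons vs v : gs_seq (rcons vs v) = gs_step (gs_seq vs) v.
Proof. by rewrite /gs_seq -cats1 foldl_cat. Qed.

Lemma size_gs_seq vs : size (gs_seq vs) = size vs.
Proof.
by elim/last_ind: vs => // vs v IH; rewrite gs_seq_rcons !size_rcons IH.
Qed.

Lemma take_gs_seq k vs : take k (gs_seq vs) = gs_seq (take k vs).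
Proof.
elim/last_ind: vs => [|vs v IH]; first by case: k.
have [lt_k|le_k] := ltnP (size vs) k.
  by rewrite !take_oversize // ?size_gs_seq size_rcons.
rewrite gs_seq_rcons /gs_step -!cats1 !takel_cat ?size_gs_seq //.
Qed.

Lemma row_gram_schmidt n (A : 'M[F]_(n, m)) (i : 'I_n) :
  row i (gram_schmidt A) =
  row i A - \sum_(j < n | (j < i)%N) gs_coef A i j *: row j (gram_schmidt A).
Proof.
set vs := [seq row j A | j <- enum 'I_n].
have szv : size vs = n by rewrite size_map size_enum_ord.
have nv : nth 0 vs i = row i A.
  by rewrite (nth_map i) ?size_enum_ord // nth_ord_enum.
have rG j : row j (gram_schmidt A) = nth 0 (gs_seq vs) j by rewrite rowK.
rewrite rG -(@nth_take i.+1 _ _ _ _ (gs_seq vs)) // take_gs_seq (take_nth 0) ?szv //.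
rewrite gs_seq_rcons nv nth_rcons size_gs_seq size_take szv ltn_ord ltnn eqxx.
congr (_ - _); rewrite (big_nth 0) size_gs_seq size_take szv ltn_ord.
pose G k := let u := (gs_seq (take i vs))`_k in
  (dotv (row i A) u / dotv u u) *: u.
rewrite big_mkord (big_ord_widen n G (ltnW (ltn_ord i))).
by apply: eq_bigr => j lt_ji; rewrite /G /gs_coef !rG -take_gs_seq nth_take.
Qed.

End GramSchmidt.

Notation Qt := {fraction {poly rat}}.

Definition Qt_of_Zpoly (p : {poly int}) : Qt :=
  FracField.tofrac (map_poly (intr : int -> rat) p).

(* Evaluates an arbitrary representative; for large [t] the value does not
   depend on it, see [Qt_evalE]. *)
Definition Qt_eval (x : Qt) (t : nat) : rat :=
  (\n_(repr x)).[t%:R] / (\d_(repr x)).[t%:R].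

Lemma eventually_horner_neq0 (q : {poly rat}) :
  q != 0 -> eventually (fun t => q.[t%:R] != 0).
Proof.
have [k] := ubnP (size q); elim: k q => // k IH q; rewrite ltnS => le_qk q0.
have [[a /factor_theorem [q1 Dq]]|nr] := pselect (exists a : nat, root q a%:R).
  have q10 : q1 != 0 by apply: contra_neq q0 => q10; rewrite Dq q10 mul0r.
  have [|//|N HN] := IH q1.
    apply: leq_trans le_qk.
    by rewrite Dq size_Mmonic ?monicXsubC // size_XsubC addn2.
  exists (maxn N a.+1) => t; rewrite geq_max => /andP[leNt ltat].
  by rewrite Dq hornerM mulf_neq0 ?HN // hornerXsubC subr_eq0 eqr_nat gtn_eqF.
by exists 0%N => t _; apply/negP => rt; apply: nr; exists t.
Qed.

Lemma Qt_evalE (p q : {poly rat}) :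
  q != 0 ->
  eventually (fun t => Qt_eval (FracField.tofrac p / FracField.tofrac q) t = p.[t%:R] / q.[t%:R]).
Proof.
move=> q0; set x := (_ / _ : Qt); set r := repr x.
have d0 : \d_r != 0 by exact: denom_ratioP.
have E : \n_r * q = p * \d_r.
  apply/eqP; rewrite -tofrac_eq !tofracM.
  have -> : FracField.tofrac \n_r = x * FracField.tofrac \d_r.
    rewrite -[x in RHS]reprK -/r; unlock FracField.tofrac.
    rewrite -[RHS]FracField.pi_mul; apply/eqmodP; rewrite /= FracField.equivfE.
    rewrite /FracField.mulf !numden_Ratio ?mulf_neq0 ?oner_neq0 //.
    by rewrite !mulr1 mul1r mulrC.
  by rewrite mulrAC divfK ?tofrac_eq0.
have [N1 H1] := eventually_horner_neq0 q0.
have [N2 H2] := eventually_horner_neq0 d0.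
exists (maxn N1 N2) => t; rewrite geq_max => /andP[/H1 qt /H2 dt].
by apply/eqP; rewrite /Qt_eval -/r eqr_div // -!hornerM E.
Qed.

Definition Qt_mx n m (h : 'M[{poly int}]_(n, m)) : 'M[Qt]_(n, m) :=
  map_mx Qt_of_Zpoly h.

Definition norm2 m (v : 'rV[rat]_m) : rat := dotv v v.

Section EventuallyLLL.
Variables (R : realType) (delta : R) (n m : nat).

Definition gs_vec_at (h : 'M[{poly int}]_(n, m)) (i : 'I_n) (t : nat) :
    'rV[rat]_m :=
  map_mx (fun x => Qt_eval x t) (row i (gram_schmidt (Qt_mx h))).

Definition gs_coef_at (h : 'M[{poly int}]_(n, m)) (i j : 'I_n) (t : nat) :
    rat :=
  Qt_eval (gs_coef (Qt_mx h) i j) t.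

Definition eventually_LLL_reduced (h : 'M[{poly int}]_(n, m)) : Prop :=
  row_free (Qt_mx h) /\
  eventually (fun t =>
    (forall i j : 'I_n, (j < i)%N -> `|gs_coef_at h i j t| <= 2^-1) /\
    (forall i j : 'I_n, i = j.+1 :> nat ->
       delta <= ratr (norm2 (gs_vec_at h i t) / norm2 (gs_vec_at h j t)
                      + gs_coef_at h i j t ^+ 2))).

Definition eval_mx (h : 'M[{poly int}]_(n, m)) (t : nat) : 'M[int]_(n, m) :=
  map_mx (fun p => p.[t%:R]) h.

Definition EQP_coords_mod (M : nat) (g : nat -> 'M[int]_(n, m)) : Prop :=
  forall i k, EQP_mod M (fun t => (g t i k)%:~R).

Definition EQP_coords (g : nat -> 'M[int]_(n, m)) : Prop :=
  forall i k, EQP (fun t => (g t i k)%:~R).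

(* An integer-valued polynomial may have non-integral coefficients, so not
   every common period [M] puts all the [g (M * t + r)] in Z[t]; some does. *)
Definition eventually_LLL_reduced_EQP (g : nat -> 'M[int]_(n, m)) : Prop :=
  exists M : nat,
    [/\ (0 < M)%N, EQP_coords_mod M g &
     forall r : 'I_M, exists h : 'M[{poly int}]_(n, m),
       eventually (fun t => g (M * t + r)%N = eval_mx h t) /\
       eventually_LLL_reduced h].

End EventuallyLLL.

Definition int_span n m (A : 'M[int]_(n, m)) (v : 'rV[int]_m) : Prop :=
  inIntSpan [tuple row i A | i < n] v.

Definition lattice_basis n m (L : 'rV[int]_m -> Prop) (B : 'M[int]_(n, m)) :
    Prop :=
  (forall v, L v <-> int_span B v) /\
  (forall c : 'I_n -> int,
     \sum_(i < n) row i B *~ c i = 0 -> forall i, c i = 0).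

(* Main.v *)
(* The LLL algorithm is run on the whole family at once. Every Gram-Schmidt
   coefficient is a rational function of [t], so all comparisons are eventually
   constant, and rounding it to a polynomial costs only a splitting of [t] into
   residue classes. Termination rests on the product [D] of the leading Gram
   minors, a polynomial in Z[t] multiplied by a factor [B < delta] at each swap
   and unchanged by size reduction. Either the degree of [D] drops, or it stays
   and [B] is bounded away from 0; in the latter case bounded coefficients stay
   bounded, so that later roundings are by constants and no new splitting is
   needed. The leading coefficient of [D] is then a positive integer which
   decreases strictly, whereas a change of [t] into [M t + r] would rescale it. *)

Require Import Defs.
From mathcomp Require Import all_boot all_order all_algebra.
From mathcomp Require Import boolp reals.
From mathcomp Require Import perm ring lra zify.

Set Implicit Arguments.
Unset Strict Implicit.
Unset Printing Implicit Defensive.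

Import Order.TTheory GRing.Theory Num.Theory.
Local Open Scope ring_scope.

(** Whenever a new degree of [D] is entered, one size reduction that may split [t] brings all
    coefficients to at most 1/2 in absolute value, and only from there on is splitting forbidden.
    Boundedness survives a swap because the new coefficients are polynomials in the old ones and
    [1/B]. If the degree of [D] drops, [B] tends to 0 and boundedness may be lost; this is harmless,
    because splitting is then allowed again: a substitution keeps the degree.

    Positivity arguments (norms, minors, effect of a swap) are carried out on the rational matrices
    obtained at each large [t]; the field Q(t) serves to show that their Gram-Schmidt data agree
    with rational functions from some [t] on. These data are recognised by uniqueness of the
    factorization into a unitriangular matrix and a matrix with nonzero orthogonal rows, so that a
    row operation only requires exhibiting the new factorization. *)

(** * Eventual properties and the growth of polynomials *)

Lemma eventually_sub (P Q : nat -> Prop) :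
  eventually P -> (forall t, P t -> Q t) -> eventually Q.
Proof. by move=> [N HN] PQ; exists N => t /HN/PQ. Qed.

Lemma eventually_and (P Q : nat -> Prop) :
  eventually P -> eventually Q -> eventually (fun t => P t /\ Q t).
Proof.
move=> [N HN] [K HK]; exists (maxn N K) => t; rewrite geq_max => /andP[Nt Kt].
by split; [apply: HN | apply: HK].
Qed.

Lemma eventually_sub2 (P Q S : nat -> Prop) :
  eventually P -> eventually Q -> (forall t, P t -> Q t -> S t) -> eventually S.
Proof.
by move=> eP eQ PQS; apply: (eventually_sub (eventually_and eP eQ)) => t []; apply: PQS.
Qed.

Lemma eventually_forall (I : finType) (P : I -> nat -> Prop) :
  (forall i, eventually (P i)) -> eventually (fun t => forall i, P i t).
Proof.
move=> /fin_all_exists[N HN]; exists (\max_i N i) => t Nt i; apply: HN.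
exact: leq_trans (leq_bigmax i) Nt.
Qed.

Lemma eventually_affine (P : nat -> Prop) k s :
  (0 < k)%N -> eventually P -> eventually (fun t => P (k * t + s)%N).
Proof. by move=> k0 [N HN]; exists N => t Nt; apply: HN; nia. Qed.

Lemma eventually_exists (P : nat -> Prop) : eventually P -> exists t, P t.
Proof. by case=> N HN; exists N; apply: HN. Qed.

Lemma horner_eventually_gt0 (F : archiRealFieldType) (p : {poly F}) :
  0 < lead_coef p -> eventually (fun t => 0 < p.[t%:R]).
Proof.
(* Positivity of [q] alone would not let [q * 'X] absorb the next coefficient [a]; a uniform bound
   [c <= q] does, as soon as [t > (c - a) / c]. *)
move=> p0; suff [c c0 H] : exists2 c, 0 < c & eventually (fun t => c <= p.[t%:R]).
  by apply: (eventually_sub H) => t; apply: lt_le_trans.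
elim/poly_ind: p p0 => [|q a IH]; first by rewrite lead_coef0 ltxx.
have [->|q0] := eqVneq q 0.
  rewrite mul0r add0r lead_coefC => a0; exists a => //.
  by exists 0%N => t _; rewrite hornerC.
rewrite lead_coefDl; last first.
  rewrite size_mulX // ltnS; apply: leq_trans (size_polyC_leq1 _) _.
  by rewrite size_poly_gt0.
rewrite lead_coefMX => /IH[c c0 [N HN]]; exists c => //.
exists (maxn N (Num.bound (`|c - a| / c))) => t; rewrite geq_max => /andP[/HN Hq tB].
have : (c - a) / c < t%:R.
  apply: (@le_lt_trans _ _ (`|c - a| / c)).
    by rewrite ler_pM2r ?invr_gt0 // ler_norm.
  apply: lt_le_trans (archi_boundP _) _; first by rewrite divr_ge0 // ltW.
  by rewrite ler_nat.
rewrite ltr_pdivrMr // !hornerE => Ht.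
have : c * t%:R <= q.[t%:R] * t%:R by rewrite ler_wpM2r.
by lra.
Qed.

Lemma horner_eventually_sign (F : archiRealFieldType) (p : {poly F}) :
  [\/ p = 0, eventually (fun t => 0 < p.[t%:R]) |
      eventually (fun t => p.[t%:R] < 0)].
Proof.
have [->|p0] := eqVneq p 0; first by constructor 1.
have [lp|lp|/eqP] := ltrgt0P (lead_coef p); last by rewrite lead_coef_eq0 (negPf p0).
  by constructor 2; apply: horner_eventually_gt0.
constructor 3; have lN : 0 < lead_coef (- p) by rewrite lead_coefN oppr_gt0.
by apply: (eventually_sub (horner_eventually_gt0 lN)) => t; rewrite hornerN oppr_gt0.
Qed.

Lemma lead_coef_gt0 (F : archiRealFieldType) (p : {poly F}) :
  eventually (fun t => 0 < p.[t%:R]) -> 0 < lead_coef p.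
Proof.
move=> Hp; rewrite ltNge le_eqVlt negb_or; apply/andP; split.
  rewrite lead_coef_eq0; apply/eqP => p0.
  by have [t] := eventually_exists Hp; rewrite p0 horner0 ltxx.
rewrite -oppr_gt0 -lead_coefN; apply/negP => /horner_eventually_gt0 Hn.
have [t] := eventually_exists (eventually_and Hp Hn).
by rewrite hornerN => -[]; lra.
Qed.

Lemma eventually_horner_inj (F : archiRealFieldType) (p q : {poly F}) :
  eventually (fun t => p.[t%:R] = q.[t%:R]) -> p = q.
Proof.
move=> Hpq; apply/eqP; rewrite -subr_eq0; apply/eqP.
have [//|H|H] := horner_eventually_sign (p - q);
have [t] := eventually_exists (eventually_and Hpq H);
by rewrite !hornerE => -[->]; rewrite subrr ltxx.
Qed.

Lemma size_le_of_eventually (F : archiRealFieldType) (p q : {poly F}) :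
  eventually (fun t => 0 < q.[t%:R] <= p.[t%:R]) -> (size q <= size p)%N.
Proof.
move=> H; rewrite leqNgt; apply/negP => ltpq.
have q0 : 0 < lead_coef q by apply: lead_coef_gt0; apply: eventually_sub H _ => t /andP[].
have : 0 < lead_coef (q - p) by rewrite lead_coefDl ?size_polyN.
move=> /horner_eventually_gt0 H'.
have [t] := eventually_exists (eventually_and H H').
by rewrite !hornerE => -[/andP[_]]; lra.
Qed.

Lemma lead_coefB_same_size (R : nzRingType) (p q : {poly R}) :
  size p = size q -> lead_coef p != lead_coef q ->
  lead_coef (p - q) = lead_coef p - lead_coef q.
Proof.
move=> spq npq; have sz : size (p - q) = size p; last first.
  by rewrite !lead_coefE sz coefB -spq.
apply/eqP; rewrite eqn_leq; apply/andP; split.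
  by rewrite (leq_trans (size_polyD _ _)) // size_polyN -spq maxnn.
rewrite leqNgt; apply/negP => lt_sz; case/negP: npq; rewrite -subr_eq0.
rewrite !lead_coefE -spq -coefB nth_default //.
by move: lt_sz; case: (size p).
Qed.

Lemma lead_coef_le_of_eventually (F : archiRealFieldType) (p q : {poly F}) :
  size q = size p ->
  eventually (fun t => q.[t%:R] <= p.[t%:R]) -> lead_coef q <= lead_coef p.
Proof.
move=> spq H; rewrite leNgt; apply/negP => lt_pq.
have : 0 < lead_coef (q - p).
  by rewrite lead_coefB_same_size ?subr_gt0 // gt_eqF.
move=> /horner_eventually_gt0 H'.
have [t] := eventually_exists (eventually_and H H').
by rewrite !hornerE => -[]; lra.
Qed.

(** With [c] half the ratio of the leading coefficients, [q - c *: p] keeps half the leading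
    coefficient of [q]. For [D] before and after a swap of constant degree, this bounds [B] from
    below. *)
Lemma eventually_ge_of_same_size (F : archiRealFieldType) (p q : {poly F}) :
  size q = size p -> 0 < lead_coef q -> 0 < lead_coef p ->
  exists2 c, 0 < c & eventually (fun t => c * p.[t%:R] <= q.[t%:R]).
Proof.
move=> sqp q0 p0; set c := lead_coef q / lead_coef p / 2%:R.
have c0 : 0 < c by rewrite !divr_gt0.
exists c => //; have lE : lead_coef (c *: p) = lead_coef q / 2%:R.
  by rewrite lead_coefZ /c mulrAC divfK ?gt_eqF.
have : 0 < lead_coef (q - c *: p).
  rewrite lead_coefB_same_size ?size_scale ?gt_eqF // ?lE; lra.
move=> /horner_eventually_gt0 H; apply: eventually_sub H _ => t.
by rewrite !hornerE; lra.
Qed.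

(** * Germs of rational functions *)

Definition eventually_bounded (u : nat -> rat) : Prop :=
  exists C, eventually (fun t => `|u t| <= C).

Lemma eventually_bounded_ext u v :
  eventually (fun t => u t = v t) -> eventually_bounded u -> eventually_bounded v.
Proof.
move=> uv [C HC]; exists C; apply: (eventually_sub2 uv HC) => t -> //.
Qed.

Lemma eventually_bounded_cst c : eventually_bounded (fun=> c).
Proof. by exists `|c|, 0%N. Qed.

Lemma eventually_boundedD u v : eventually_bounded u -> eventually_bounded v ->
  eventually_bounded (fun t => u t + v t).
Proof.
move=> [C HC] [D HD]; exists (C + D); apply: (eventually_sub2 HC HD) => t Ct Dt.
exact: le_trans (ler_normD _ _) (lerD Ct Dt).
Qed.

Lemma eventually_boundedM u v : eventually_bounded u -> eventually_bounded v ->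
  eventually_bounded (fun t => u t * v t).
Proof.
move=> [C HC] [D HD]; exists (C * D); apply: (eventually_sub2 HC HD) => t Ct Dt.
by rewrite normrM ler_pM.
Qed.

Lemma eventually_boundedB u v : eventually_bounded u -> eventually_bounded v ->
  eventually_bounded (fun t => u t - v t).
Proof.
move=> [C HC] [D HD]; exists (C + D); apply: (eventually_sub2 HC HD) => t Ct Dt.
exact: le_trans (ler_normB _ _) (lerD Ct Dt).
Qed.

Lemma eventually_bounded_affine u k s : (0 < k)%N ->
  eventually_bounded u -> eventually_bounded (fun t => u (k * t + s)%N).
Proof. by move=> k0 [C HC]; exists C; apply: (eventually_affine s k0 HC). Qed.

Local Notation tofrac := (@FracField.tofrac {poly rat}).

Lemma Qt_fracP (x : Qt) :
  exists p q : {poly rat}, q != 0 /\ x = tofrac p / tofrac q.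
Proof.
exists \n_(repr x), \d_(repr x).
have d0 : \d_(repr x) != 0 by exact: denom_ratioP.
split=> //; apply: canRL (mulfK _) _; rewrite ?tofrac_eq0 //.
rewrite -[x in LHS]reprK; set r := repr x; unlock FracField.tofrac.
rewrite -[LHS]FracField.pi_mul; apply/eqmodP; rewrite /= FracField.equivfE.
rewrite /FracField.mulf !numden_Ratio ?mulf_neq0 ?oner_neq0 //.
by rewrite !mulr1 mulrC reprK.
Qed.

Lemma Qt_evalC (p : {poly rat}) :
  eventually (fun t => Qt_eval (tofrac p) t = p.[t%:R]).
Proof.
have := Qt_evalE p (oner_neq0 _); rewrite tofrac1 divr1 => H.
by apply: eventually_sub H _ => t ->; rewrite hornerC divr1.
Qed.

Lemma Qt_evalD x y :
  eventually (fun t => Qt_eval (x + y) t = Qt_eval x t + Qt_eval y t).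
Proof.
have [p [q [q0 ->]]] := Qt_fracP x; have [r [s [s0 ->]]] := Qt_fracP y.
rewrite addf_div ?tofrac_eq0 // -!tofracM -tofracD.
have H := eventually_and (Qt_evalE p q0) (Qt_evalE r s0).
have H1 := eventually_and (eventually_horner_neq0 q0) (eventually_horner_neq0 s0).
have H2 := Qt_evalE (p * s + r * q) (mulf_neq0 q0 s0).
apply: (eventually_sub2 (eventually_and H H1) H2) => t [[-> ->] [qt st]] ->.
by rewrite addf_div // !hornerE.
Qed.

Lemma Qt_evalM x y :
  eventually (fun t => Qt_eval (x * y) t = Qt_eval x t * Qt_eval y t).
Proof.
have [p [q [q0 ->]]] := Qt_fracP x; have [r [s [s0 ->]]] := Qt_fracP y.
rewrite mulf_div -!tofracM.
have H := eventually_and (Qt_evalE p q0) (Qt_evalE r s0).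
have H2 := Qt_evalE (p * r) (mulf_neq0 q0 s0).
apply: (eventually_sub2 H H2) => t [-> ->] ->.
by rewrite mulf_div !hornerE.
Qed.

Lemma Qt_eval0 : eventually (fun t => Qt_eval 0 t = 0).
Proof. by have := Qt_evalC 0; rewrite tofrac0; under eq_fun do rewrite horner0. Qed.

Lemma Qt_eval1 : eventually (fun t => Qt_eval 1 t = 1).
Proof. by have := Qt_evalC 1; rewrite tofrac1; under eq_fun do rewrite hornerC. Qed.

(** The convention [0^-1 = 0] holds on both sides, so the Gram-Schmidt process can be evaluated
    without nondegeneracy hypotheses. *)
Lemma Qt_evalV x : eventually (fun t => Qt_eval x^-1 t = (Qt_eval x t)^-1).
Proof.
have [->|x0] := eqVneq x 0.
  by rewrite invr0; apply: eventually_sub Qt_eval0 _ => t ->; rewrite invr0.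
have := Qt_evalM x x^-1; rewrite mulfV // => H.
apply: (eventually_sub2 H Qt_eval1) => t H1 H2.
move: H1; rewrite H2 => H1; have xt : Qt_eval x t != 0.
  by apply: contraTneq isT => xt; move: H1; rewrite xt mul0r => /eqP; rewrite oner_eq0.
by apply: (mulfI xt); rewrite -H1 mulfV.
Qed.

Lemma Qt_evalN x : eventually (fun t => Qt_eval (- x) t = - Qt_eval x t).
Proof.
have := Qt_evalD x (- x); rewrite subrr => H.
apply: (eventually_sub2 H Qt_eval0) => t -> /eqP; rewrite addrC addr_eq0.
by move/eqP.
Qed.

Lemma Qt_eval_sum (I : Type) (r : seq I) (F : I -> Qt) :
  eventually (fun t => Qt_eval (\sum_(i <- r) F i) t = \sum_(i <- r) Qt_eval (F i) t).
Proof.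
elim: r => [|i r IH].
  rewrite big_nil; apply: eventually_sub Qt_eval0 _ => t ->; by rewrite big_nil.
rewrite big_cons; apply: (eventually_sub2 IH (Qt_evalD (F i) (\sum_(j <- r) F j))) => t IHt ->.
by rewrite big_cons IHt.
Qed.

Lemma Qt_eval_eq0 x : eventually (fun t => Qt_eval x t = 0) -> x = 0.
Proof.
move=> H; apply/eqP; apply: contraT => x0.
have := Qt_evalM x x^-1; rewrite mulfV // => HM.
have [t] := eventually_exists (eventually_and (eventually_and H HM) Qt_eval1).
by move=> [[-> ->]]; rewrite mul0r => /eqP; rewrite eq_sym oner_eq0.
Qed.

(** A property of functions of [t], not an element of [Qt], so that it applies directly to the data
    of evaluated matrices and to their restrictions to residue classes. *)
Definition rational_germ (u : nat -> rat) : Prop :=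
  exists x : Qt, eventually (fun t => u t = Qt_eval x t).

Lemma rational_germP u : rational_germ u <->
  exists p q : {poly rat}, q != 0 /\ eventually (fun t => u t = p.[t%:R] / q.[t%:R]).
Proof.
split=> [[x Hx]|[p [q [q0 H]]]].
  have [p [q [q0 xE]]] := Qt_fracP x; exists p, q; split=> //.
  by apply: eventually_sub2 Hx (Qt_evalE p q0) _ => t ->; rewrite -xE.
exists (tofrac p / tofrac q).
by apply: eventually_sub2 H (Qt_evalE p q0) _ => t -> ->.
Qed.

Lemma rational_germ_ext u v :
  eventually (fun t => u t = v t) -> rational_germ u -> rational_germ v.
Proof.
by move=> uv [x Hx]; exists x; apply: eventually_sub2 uv Hx _ => t ->.
Qed.

Lemma rational_germ_poly (p : {poly rat}) : rational_germ (fun t => p.[t%:R]).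
Proof. by exists (tofrac p); apply: eventually_sub (Qt_evalC p) _ => t ->. Qed.

Lemma rational_germ_cst c : rational_germ (fun=> c).
Proof.
by apply: rational_germ_ext (rational_germ_poly c%:P); exists 0%N => t _; rewrite hornerC.
Qed.

Lemma rational_germD u v :
  rational_germ u -> rational_germ v -> rational_germ (fun t => u t + v t).
Proof.
move=> [x Hx] [y Hy]; exists (x + y).
by apply: eventually_sub2 (eventually_and Hx Hy) (Qt_evalD x y) _ => t [-> ->].
Qed.

Lemma rational_germB u v :
  rational_germ u -> rational_germ v -> rational_germ (fun t => u t - v t).
Proof.
move=> Hu [y Hy]; apply: rational_germD => //; exists (- y).
by apply: eventually_sub2 Hy (Qt_evalN y) _ => t -> ->.
Qed.

Lemma rational_germM u v :
  rational_germ u -> rational_germ v -> rational_germ (fun t => u t * v t).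
Proof.
move=> [x Hx] [y Hy]; exists (x * y).
by apply: eventually_sub2 (eventually_and Hx Hy) (Qt_evalM x y) _ => t [-> ->].
Qed.

Lemma rational_germV u : rational_germ u -> rational_germ (fun t => (u t)^-1).
Proof.
move=> [x Hx]; exists x^-1.
by apply: eventually_sub2 Hx (Qt_evalV x) _ => t -> ->.
Qed.

Definition affine_poly (R : nzRingType) (k s : nat) : {poly R} := k%:R *: 'X + s%:R%:P.

Lemma size_affine_poly (R : numDomainType) k s :
  (0 < k)%N -> size (affine_poly R k s) = 2%N.
Proof.
move=> k0; have kR : (k%:R : R) != 0 by rewrite pnatr_eq0 -lt0n.
by rewrite size_polyDl size_scale ?size_polyX // ltnS size_polyC_leq1.
Qed.

Lemma horner_comp_affine (R : comNzRingType) (p : {poly R}) k s t :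
  (p \Po affine_poly R k s).[t%:R] = p.[(k * t + s)%:R].
Proof. by rewrite horner_comp !hornerE natrD natrM. Qed.

Lemma rational_germ_affine u k s : (0 < k)%N ->
  rational_germ u -> rational_germ (fun t => u (k * t + s)%N).
Proof.
move=> k0 /rational_germP[p [q [q0 H]]]; apply/rational_germP.
exists (p \Po affine_poly _ k s), (q \Po affine_poly _ k s); split.
  by rewrite -size_poly_eq0 size_comp_poly2 ?size_affine_poly // size_poly_eq0.
by apply: eventually_sub (eventually_affine s k0 H) _ => t ->; rewrite !horner_comp_affine.
Qed.

(** Multiplied by the square of its denominator [q], [u - c] becomes the polynomial [(p - c q) q],
    whose sign is eventually constant. The field [F] is there because the LLL factor is real. *)
Lemma rational_germ_cmp (F : archiRealFieldType) (c : F) u : rational_germ u ->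
  eventually (fun t => c <= ratr (u t)) \/ eventually (fun t => ratr (u t) < c).
Proof.
move=> /rational_germP[p [q [q0 H]]].
pose f := map_poly (ratr : rat -> F).
have fE (s : {poly rat}) (t : nat) : (f s).[t%:R] = ratr s.[t%:R].
  by rewrite -(ratr_nat F) horner_map.
have Hq := eventually_horner_neq0 q0.
have Hs : eventually (fun t => (ratr (u t) - c) * ratr (q.[t%:R]) ^+ 2 =
     ((f p - c *: f q) * f q).[t%:R]).
  apply: eventually_sub2 H Hq _ => t -> qt; rewrite hornerM hornerD hornerN hornerZ !fE fmorph_div.
  have := qt; rewrite -(fmorph_eq0 (ratr : rat -> F)); set b : F := ratr q.[_] => b0.
  by rewrite expr2 mulrA mulrBl divfK.
have q2 t : q.[t%:R] != 0 -> 0 < (ratr q.[t%:R] : F) ^+ 2.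
  by move=> qt; rewrite exprn_even_gt0 // fmorph_eq0.
case: (horner_eventually_sign ((f p - c *: f q) * f q)) => [s0|Hs'|Hs'].
- left; apply: eventually_sub2 Hs Hq _ => t E qt; move: E; rewrite s0 horner0.
  by move/eqP; rewrite mulf_eq0 (gt_eqF (q2 _ qt)) orbF subr_eq0 => /eqP ->.
- left; apply: eventually_sub2 (eventually_and Hs Hs') Hq _ => t [<- +] qt.
  by rewrite pmulr_lgt0 ?q2 // subr_gt0 => /ltW.
- right; apply: eventually_sub2 (eventually_and Hs Hs') Hq _ => t [<- +] qt.
  by rewrite pmulr_llt0 ?q2 // subr_lt0.
Qed.

Lemma rational_germ_le_or_gt (c : rat) u : rational_germ u ->
  eventually (fun t => u t <= c) \/ eventually (fun t => c < u t).
Proof.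
move=> /(rational_germB (rational_germ_cst 0)) /(rational_germ_cmp (- c)).
by case=> H; [left|right]; apply: eventually_sub H _ => t;
  rewrite sub0r -(fmorph_eq_rat idfun) /=; lra.
Qed.

(** * Rounding germs to integer polynomials *)

Lemma horner_intr (F : numFieldType) (p : {poly int}) (t : nat) :
  (map_poly (intr : int -> F) p).[t%:R] = (p.[t%:R])%:~R.
Proof. by rewrite -[t%:R in LHS](rmorph_nat (intr : int -> F)) horner_map. Qed.

Lemma size_map_intr (F : numFieldType) (p : {poly int}) :
  size (map_poly (intr : int -> F) p) = size p.
Proof. by apply: size_map_inj_poly => //; apply: intr_inj. Qed.

Lemma lead_coef_map_intr (F : numFieldType) (p : {poly int}) :
  lead_coef (map_poly (intr : int -> F) p) = (lead_coef p)%:~R.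
Proof. by apply: lead_coef_map_inj => //; apply: intr_inj. Qed.

Lemma eventually_horner_int_inj (p q : {poly int}) :
  eventually (fun t => p.[t%:R] = q.[t%:R]) -> p = q.
Proof.
move=> H; apply: (map_inj_poly (f := (intr : int -> rat))) => //; first exact: intr_inj.
by apply: eventually_horner_inj; apply: eventually_sub H _ => t; rewrite !horner_intr => ->.
Qed.

(** The rounding is the least integer [z] with [u <= z + 1/2] eventually: as the same bound fails
    for [z - 1] and comparisons are eventually decided, [u] eventually exceeds [z - 1/2]. The shift
    by [K] makes this a search over naturals; at its lower end the bound on [u] replaces
    minimality. *)
Lemma round_bounded_germ u : rational_germ u -> eventually_bounded u ->
  exists z : int, eventually (fun t => `|u t - z%:~R| <= 2^-1).
Proof.
move=> ru [C HC]; pose K := Num.bound `|C|.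
have CK : C < K%:R by apply: le_lt_trans (ler_norm C) _; exact: archi_boundP.
pose P (k : nat) := `[< eventually (fun t => u t <= k%:R - K%:R + 2^-1) >].
have exP : exists k, P k.
  exists (K + K)%N; apply/asboolP; apply: eventually_sub HC _ => t.
  by rewrite natrD ler_norml => /andP[_]; lra.
case: (ex_minnP exP) => k /asboolP Pk kmin; exists (k%:Z - K%:Z).
have zE : ((k%:Z - K%:Z)%:~R : rat) = k%:R - K%:R by rewrite intrB.
suff Hlow : eventually (fun t => k%:R - K%:R - 2^-1 <= u t).
  by apply: eventually_sub2 Pk Hlow _ => t; rewrite zE ler_norml; lra.
case: k {zE} Pk kmin => [|k] Pk kmin.
  by apply: eventually_sub HC _ => t; rewrite ler_norml => /andP[+ _]; lra.
have [H|H] := rational_germ_le_or_gt (k%:R - K%:R + 2^-1) ru.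
  by have /kmin : P k; [exact/asboolP | rewrite ltnn].
by apply: eventually_sub H _ => t; rewrite -[k.+1]addn1 natrD; lra.
Qed.

Lemma horner_affine_mod (A : {poly int}) (d : int) (r : nat) :
  exists q : {poly int}, forall t : nat,
    A.[(`|d| * t + r)%:R] = d * q.[t%:R] + A.[r%:R].
Proof.
elim/poly_ind: A => [|B c [q Hq]].
  by exists 0 => t; rewrite !horner0 mulr0 addr0.
(* Expand [(d q + B(r)) (|d| t + r) + c] and collect the multiples of [d], writing [|d|] as
   [sg d * d]. *)
exists (q * affine_poly _ `|d| r + (B.[r%:R] * Num.sg d) *: 'X) => t.
have dE : `|d|%N%:R = Num.sg d * d :> int by rewrite natz abszE normrEsg.
rewrite !hornerE Hq natrD natrM dE /=.
ring.
Qed.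

(** The period is a common denominator of the coefficients, so the fractional part of [a] is
    constant on each residue class. *)
Lemma round_poly_affine (a : {poly rat}) :
  exists2 M : nat, (0 < M)%N & forall r : nat, exists q : {poly int},
    forall t : nat, a.[(M * t + r)%:R] = (q.[t%:R])%:~R + a.[r%:R].
Proof.
have [A [d d0 ->]] := rat_poly_scale a; exists `|d|%N; first by rewrite absz_gt0.
move=> r; have [q Hq] := horner_affine_mod A d r; exists q => t.
rewrite !hornerZ !horner_intr Hq intrD intrM mulrDr mulKf // intr_eq0 //.
Qed.

(** Euclidean division writes [u] as a polynomial plus a bounded fraction. On a residue class the
    polynomial is integral up to a constant, so what remains is bounded and is rounded by a
    constant. A bounded [u] needs no division, hence no split. *)
Lemma round_germ u : rational_germ u ->
  exists M : nat, [/\ (0 < M)%N, eventually_bounded u -> M = 1%N &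
    forall r : nat, exists q : {poly int},
      eventually (fun t => `|u (M * t + r)%N - (q.[t%:R])%:~R| <= 2^-1)].
Proof.
move=> ru; have [bu|nbu] := pselect (eventually_bounded u).
  exists 1%N; split=> // r.
  have [z Hz] := round_bounded_germ (rational_germ_affine r (ltn0Sn 0) ru)
                   (eventually_bounded_affine r (ltn0Sn 0) bu).
  by exists z%:P; apply: eventually_sub Hz _ => t; rewrite hornerC.
have /rational_germP[p [s [s0 Hu]]] := ru.
have [M M0 HM] := round_poly_affine (p %/ s).
exists M; split=> // r; have [q Hq] := HM r.
pose v t := u (M * t + r)%N - (q.[t%:R])%:~R.
have rv : rational_germ v.
  apply: rational_germB (rational_germ_affine r M0 ru) _.
  apply: rational_germ_ext (rational_germ_poly (map_poly intr q)).
  by exists 0%N => t _; rewrite horner_intr.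
have bv : eventually_bounded v.
  pose w t := (p %% s).[t%:R] / s.[t%:R].
  have bw : eventually_bounded w.
    (* The remainder has smaller degree than [s], so [s ^+ 2] dominates its square. *)
    exists 1; have : 0 < lead_coef (s ^+ 2 - (p %% s) ^+ 2).
      rewrite lead_coefDl; first by rewrite lead_coef_exp exprn_even_gt0 // lead_coef_eq0.
      have [->|m0] := eqVneq (p %% s) 0.
        by rewrite expr0n oppr0 size_poly0 size_poly_gt0 expf_neq0.
      have := ltn_modp p s; rewrite s0 => lt_ms.
      rewrite size_polyN !expr2 !size_mul //.
      move: lt_ms m0; rewrite -size_poly_gt0; move: (size _) (size _) => a b.
      by lia.
    move=> /horner_eventually_gt0 H.
    apply: eventually_sub2 H (eventually_horner_neq0 s0) _ => t.
    rewrite !hornerE => H st; rewrite /w normrM normfV ler_pdivrMr ?normr_gt0 // mul1r.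
    by rewrite -(@ler_pXn2r _ 2) ?nnegrE // !real_normK ?num_real //; lra.
  apply: eventually_bounded_ext
    (eventually_boundedD (eventually_bounded_affine r M0 bw)
                         (eventually_bounded_cst (p %/ s).[r%:R])).
  have H2 := eventually_affine r M0 (eventually_and Hu (eventually_horner_neq0 s0)).
  apply: eventually_sub H2 _ => t [ut st].
  have pE x : p.[x] = (p %/ s).[x] * s.[x] + (p %% s).[x].
    by rewrite {1}(divp_eq p s) !hornerE.
  by rewrite /v /w ut pE mulrDl mulfK // Hq; ring.
have [z Hz] := round_bounded_germ rv bv.
exists (q + z%:P); apply: eventually_sub Hz _ => t.
by rewrite /v !hornerE intrD opprD addrA.
Qed.

(** * Gram-Schmidt orthogonalization and row operations *)

(** Defined over any commutative ring, so that one formula gives the polynomial [D] and, by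
    [gram_prod_map], its values. Since [ltn_ord k] reads as [k.+1 <= n], the minor of index [k] has
    size [k.+1]. *)
Definition gram_prod (R : comNzRingType) n m (A : 'M[R]_(n, m)) : R :=
  \prod_(k < n) \det (mxsub (widen_ord (ltn_ord k)) (widen_ord (ltn_ord k)) (A *m A^T)).

Lemma gram_prod_map (R S : comNzRingType) (f : {rmorphism R -> S}) n m (A : 'M[R]_(n, m)) :
  gram_prod (map_mx f A) = f (gram_prod A).
Proof.
rewrite rmorph_prod; apply: eq_bigr => k _.
by rewrite map_trmx -map_mxM -map_mxsub det_map_mx.
Qed.

Section GramSchmidtDecomposition.
Variable F : realFieldType.

Section Dot.
Variable m : nat.
Implicit Types u v w : 'rV[F]_m.

Lemma dotvE u v : dotv u v = (u *m v^T) 0 0.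
Proof. by rewrite mxE; apply: eq_bigr => k _; rewrite mxE. Qed.

Lemma dotvC u v : dotv u v = dotv v u.
Proof. by apply: eq_bigr => k _; rewrite mulrC. Qed.

Lemma dotvDl u v w : dotv (u + v) w = dotv u w + dotv v w.
Proof. by rewrite !dotvE mulmxDl mxE. Qed.

Lemma dotvBl u v w : dotv (u - v) w = dotv u w - dotv v w.
Proof. by rewrite !dotvE mulmxBl !mxE. Qed.

Lemma dotvZl a u v : dotv (a *: u) v = a * dotv u v.
Proof. by rewrite !dotvE -scalemxAl mxE. Qed.

Lemma dotvDr u v w : dotv w (u + v) = dotv w u + dotv w v.
Proof. by rewrite !(dotvC w) dotvDl. Qed.

Lemma dotvBr u v w : dotv w (u - v) = dotv w u - dotv w v.
Proof. by rewrite !(dotvC w) dotvBl. Qed.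

Lemma dotvZr a u v : dotv v (a *: u) = a * dotv v u.
Proof. by rewrite !(dotvC v) dotvZl. Qed.

Lemma dotv_suml (I : Type) (r : seq I) (P : pred I) (f : I -> 'rV[F]_m) v :
  dotv (\sum_(i <- r | P i) f i) v = \sum_(i <- r | P i) dotv (f i) v.
Proof. by rewrite dotvE mulmx_suml summxE; apply: eq_bigr => i _; rewrite dotvE. Qed.

Lemma dotv0 u : dotv u 0 = 0.
Proof. by rewrite dotvE trmx0 mulmx0 mxE. Qed.

Lemma dotv_ge0 u : 0 <= dotv u u.
Proof. by apply: sumr_ge0 => k _; rewrite -expr2 sqr_ge0. Qed.

Lemma dotv_eq0 u : (dotv u u == 0) = (u == 0).
Proof.
apply/eqP/eqP => [/eqP|->]; last exact: dotv0.
rewrite psumr_eq0 => [|k _]; last by rewrite -expr2 sqr_ge0.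
move=> /allP u0; apply/rowP => k; rewrite mxE; apply/eqP.
by have := u0 k (mem_index_enum k); rewrite /= mulf_eq0 orbb.
Qed.

End Dot.

Definition unitriangular n (L : 'M[F]_n) :=
  forall i j : 'I_n, (i <= j)%N -> L i j = (i == j)%:R.

Lemma unitriangularM n (L K : 'M[F]_n) :
  unitriangular L -> unitriangular K -> unitriangular (L *m K).
Proof.
move=> HL HK i j le_ij; rewrite mxE (bigD1 i) //= HL // eqxx mul1r HK //.
rewrite big1 ?addr0 // => k ki; have [ltik|leki] := ltnP i k.
  by rewrite HL ?(ltnW ltik) // eq_sym (negPf ki) mul0r.
rewrite HK ?(leq_trans leki) //; case: eqP => [kj|]; last by rewrite mulr0.
by case/negP: ki; rewrite -val_eqE eqn_leq leki kj le_ij.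
Qed.

Lemma det_unitriangular n (L : 'M[F]_n) : unitriangular L -> \det L = 1.
Proof.
move=> HL; rewrite det_trig; last first.
  apply/is_trig_mxP => i j ij; rewrite HL ?(ltnW ij) //.
  by case: eqP => // ij'; rewrite ij' ltnn in ij.
by rewrite big1 // => i _; rewrite HL // eqxx.
Qed.

Lemma unitriangular_unit n (L : 'M[F]_n) : unitriangular L -> L \in unitmx.
Proof. by move=> /det_unitriangular HL; rewrite unitmxE HL unitr1. Qed.

Variables n m : nat.
Implicit Types A G : 'M[F]_(n, m).

(** A certificate for Gram-Schmidt data: by [gs_decomp_unique], any such pair is the result of the
    process, so the recursion need not be unfolded after a row operation. *)
Definition gs_decomp A (L : 'M[F]_n) G :=
  [/\ A = L *m G, unitriangular L,
      forall i j, i != j -> dotv (row i G) (row j G) = 0 &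
      forall i, dotv (row i G) (row i G) != 0].

Definition gs_coef_mx A : 'M[F]_n :=
  \matrix_(i, j) if (j < i)%N then gs_coef A i j else (i == j)%:R.

Lemma gs_coef_mx_unitriangular A : unitriangular (gs_coef_mx A).
Proof. by move=> i j le_ij; rewrite mxE ltnNge le_ij. Qed.

Lemma gram_schmidt_mul A : A = gs_coef_mx A *m gram_schmidt A.
Proof.
apply/row_matrixP => i; rewrite row_mul mulmx_sum_row.
have := row_gram_schmidt A i => /(canLR (subrK _)) <-.
rewrite [RHS](bigD1 i) //= [row _ _ 0 i]mxE [gs_coef_mx A i i]mxE ltnn eqxx scale1r; congr (_ + _).
rewrite [RHS]big_mkcond [LHS]big_mkcond /=; apply: eq_bigr => k _; rewrite !mxE.
case: ltngtP => [ki|ki|/val_inj->]; last by rewrite eqxx.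
  by rewrite -val_eqE /= ltn_eqF.
by rewrite -!val_eqE /= gtn_eqF // ltn_eqF // scale0r.
Qed.

Lemma gram_schmidt_orth A (i j : 'I_n) :
  i != j -> dotv (row i (gram_schmidt A)) (row j (gram_schmidt A)) = 0.
Proof.
set G := gram_schmidt A.
suff H k (a b : 'I_n) : (a < k)%N -> (b < a)%N -> dotv (row a G) (row b G) = 0.
  rewrite -val_eqE neq_ltn => /orP[ij|ij]; last exact: (H i.+1).
  by rewrite dotvC (H j.+1).
elim: k a b => // k IH a b; rewrite ltnS => le_ak lt_ba.
rewrite row_gram_schmidt -/G dotvBl dotv_suml (bigD1 b) //= dotvZl.
rewrite big1 => [|c /andP[ca cb]].
  (* No freeness is assumed: if [row b G] vanishes, so do its dot products. *)
  rewrite addr0 /gs_coef -/G; have [/eqP|nz] := eqVneq (dotv (row b G) (row b G)) 0.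
    by rewrite dotv_eq0 => /eqP ->; rewrite !dotv0 mulr0 subrr.
  by rewrite divfK // subrr.
rewrite dotvZl; move: cb; rewrite -val_eqE neq_ltn => /orP[cb|bc].
  by rewrite dotvC IH ?mulr0 //; apply: leq_trans le_ak.
by rewrite IH ?mulr0 //; apply: leq_trans le_ak.
Qed.

Lemma gs_decomp_gram_schmidt A :
  row_free A -> gs_decomp A (gs_coef_mx A) (gram_schmidt A).
Proof.
move=> fA; split; [exact: gram_schmidt_mul | exact: gs_coef_mx_unitriangular
  | exact: gram_schmidt_orth |].
have fG : row_free (gram_schmidt A).
  move: fA; rewrite {1}(gram_schmidt_mul A) => /row_freeP[B].
  rewrite -mulmxA => /mulmx1C; rewrite -mulmxA => E.
  by apply/row_freeP; exists (B *m gs_coef_mx A).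
move=> i; rewrite dotv_eq0 rowE mulmx_free_eq0 //.
apply/eqP => /matrixP/(_ 0 i); rewrite !mxE !eqxx => /eqP.
by rewrite oner_eq0.
Qed.

(** Pairing [row i A] with [row j G] isolates [L i j]. Once the earlier rows agree, their
    coefficients do too, and subtracting the same terms from [row i A] leaves [row i G]. *)
Lemma gs_decomp_unique A L G : gs_decomp A L G ->
  gram_schmidt A = G /\ forall i j : 'I_n, (j < i)%N -> gs_coef A i j = L i j.
Proof.
move=> [AE HL oG nG].
have dotA i j : dotv (row i A) (row j G) = L i j * dotv (row j G) (row j G).
  rewrite AE row_mul mulmx_sum_row dotv_suml (bigD1 j) //= dotvZl mxE.
  by rewrite big1 ?addr0 // => k kj; rewrite dotvZl oG // mulr0.
have coefE i j : row j (gram_schmidt A) = row j G -> gs_coef A i j = L i j.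
  by move=> jE; rewrite /gs_coef jE dotA mulfK.
suff H k (i : 'I_n) : (i < k)%N -> row i (gram_schmidt A) = row i G.
  split; first by apply/row_matrixP => i; apply: (H i.+1).
  by move=> i j _; apply: coefE; apply: (H j.+1).
elim: k i => // k IH i; rewrite ltnS => le_ik.
rewrite row_gram_schmidt {1}AE row_mul mulmx_sum_row (bigID (fun j : 'I_n => (j < i)%N)) /=.
rewrite addrAC -sumrB big1 ?add0r => [|j ji]; last first.
  have jE := IH _ (leq_trans ji le_ik).
  by rewrite jE (coefE _ _ jE) mxE subrr.
rewrite (bigD1 i) ?ltnn //= mxE HL // eqxx scale1r big1 ?addr0 // => j /andP[ij ji].
by rewrite mxE HL 1?leqNgt // eq_sym (negPf ji) scale0r.
Qed.

Lemma gs_decomp_mul A L G U : gs_decomp A L G -> unitriangular U ->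
  gs_decomp (U *m A) (U *m L) G.
Proof.
by move=> [-> HL oG nG] HU; split=> //; [rewrite mulmxA | apply: unitriangularM].
Qed.

(** As [L] is unitriangular, each leading minor is the product of the squared norms of the first
    rows of [G]; the norm of row [l] occurs in the [n - l] minors of index [k >= l]. *)
Lemma gram_prod_decomp A L G : gs_decomp A L G ->
  gram_prod A = \prod_(l < n) dotv (row l G) (row l G) ^+ (n - l).
Proof.
move=> [AE HL oG nG]; pose N (l : 'I_n) := dotv (row l G) (row l G).
transitivity (\prod_(k < n) \prod_(l < n | (l < k.+1)%N) N l); last first.
  rewrite (exchange_big_dep predT) //=; apply: eq_bigr => l _.
  rewrite -[RHS]prodr_const_nat big_geq_mkord.
  by apply: eq_bigl => k; rewrite ltnS.
apply: eq_bigr => k _; rewrite (big_ord_narrow (ltn_ord k)) /=.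
set w := widen_ord _; have w_inj : injective w by move=> a b /(congr1 val) /= /val_inj.
pose Lk := mxsub w w L; pose Gk := rowsub w G.
have AkE : rowsub w A = Lk *m Gk.
  apply/matrixP => a b; rewrite AE !mxE.
  under [RHS]eq_bigr do rewrite !mxE.
  rewrite -(big_ord_narrow (ltn_ord k) (F := fun l => L (w a) l * G l b)).
  apply/esym/big_rmcond => l; rewrite -leqNgt => kl.
  have al : (w a < l)%N by rewrite /= (leq_trans (ltn_ord a)).
  by rewrite HL ?(ltnW al) // -val_eqE ltn_eqF // mul0r.
have HLk : unitriangular Lk.
  by move=> a b ab; rewrite mxE HL //= (inj_eq w_inj).
have -> : mxsub w w (A *m A^T) = Lk *m (Gk *m Gk^T) *m Lk^T.
  by rewrite mxsub_mul -trmx_mxsub AkE trmx_mul !mulmxA.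
rewrite !det_mulmx det_tr (det_unitriangular HLk) mul1r mulr1.
have -> : Gk *m Gk^T = diag_mx (\row_l N (w l)).
  apply/matrixP => a b; rewrite !mxE.
  have E : \sum_j Gk a j * Gk^T j b = dotv (row (w a) G) (row (w b) G).
    by apply: eq_bigr => c _; rewrite !mxE.
  rewrite E; have [->|ab] := eqVneq a b; first by rewrite mulr1n.
  by rewrite mulr0n oG // (inj_eq w_inj).
by rewrite det_diag; apply: eq_bigr => l _; rewrite mxE.
Qed.

Lemma gram_prod_gt0 A : row_free A -> 0 < gram_prod A.
Proof.
move=> /gs_decomp_gram_schmidt D; rewrite (gram_prod_decomp D).
apply: prodr_gt0 => l _; rewrite exprn_gt0 // lt_def dotv_ge0 andbT.
by case: D.
Qed.

(** * Exchange of two adjacent rows *)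

Section Swap.
Variables (A : 'M[F]_(n, m)) (L : 'M[F]_n) (G : 'M[F]_(n, m)) (i j : 'I_n).
Hypotheses (dA : gs_decomp A L G) (ij : i = j.+1 :> nat).

Let N l := dotv (row l G) (row l G).
Let mu : F := L i j.
Let B := N i / N j + mu ^+ 2.

(** With [gj'] and [gi'] the new orthogonal vectors at positions [j] and [i], substitute
    [row j G = gi' + (mu / B) *: gj'] and [row i G = (1 - mu ^+ 2 / B) *: gj' - mu *: gi'] into the
    expansion of row [k'] of [A]. The only divisor is [B]. *)
Definition swap_coef_mx : 'M[F]_n := \matrix_(k, l)
  let k' := tperm i j k in
  if l == j then L k' i * (1 - mu ^+ 2 / B) + L k' j * (mu / B)
  else if l == i then L k' j - mu * L k' i else L k' l.

(** The part of [row i A] orthogonal to the rows before [j]. Its squared norm is [B * N j], and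
    [mu / B] is the coefficient of the projection of [row j G] on it. *)
Let gj' := row i G + mu *: row j G.
Let gi' := row j G - (mu / B) *: gj'.

Definition swap_gs_mx : 'M[F]_(n, m) :=
  \matrix_(l < n) if l == j then gj' else if l == i then gi' else row l G.

Let neq_ij : i != j. Proof. by rewrite -val_eqE /= ij gtn_eqF. Qed.

Let N_gt0 l : 0 < N l.
Proof. by rewrite lt_def dotv_ge0 andbT; case: dA => _ _ _; apply. Qed.

Let B_gt0 : 0 < B.
Proof. by rewrite ltr_wpDr ?sqr_ge0 // divr_gt0. Qed.

Let BN : B * N j = N i + mu ^+ 2 * N j.
Proof. by rewrite mulrDl divfK // gt_eqF. Qed.

Let o k l : k != l -> dotv (row k G) (row l G) = 0.
Proof. by case: dA => _ _ oG _; apply: oG. Qed.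

Let norm_gj' : dotv gj' gj' = B * N j.
Proof.
rewrite BN /gj' !dotvDl !dotvDr !dotvZl !dotvZr -!/(N _) (o neq_ij).
by rewrite dotvC (o neq_ij); ring.
Qed.

Let dot_gj'_j : dotv gj' (row j G) = mu * N j.
Proof. by rewrite dotvDl dotvZl (o neq_ij) add0r. Qed.

Let dot_gj'_gi' : dotv gj' gi' = 0.
Proof.
rewrite dotvBr dotvZr dot_gj'_j norm_gj' mulrA divfK ?subrr //.
by rewrite gt_eqF.
Qed.

Let norm_gi' : dotv gi' gi' = N i / B.
Proof.
rewrite {1}/gi' dotvBl dotvZl dot_gj'_gi' mulr0 subr0 dotvBr dotvZr.
rewrite [dotv _ gj']dotvC dot_gj'_j -/(N j).
apply: (mulIf (x := B)); first by rewrite gt_eqF.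
have -> : N i = B * N j - mu ^+ 2 * N j by rewrite BN addrK.
by field; rewrite gt_eqF.
Qed.

Let dot_gj'_other l : l != j -> l != i -> dotv gj' (row l G) = 0.
Proof.
move=> lj li; rewrite dotvDl dotvZl !o ?mulr0 ?addr0 //; by rewrite eq_sym.
Qed.

Let dot_gi'_other l : l != j -> l != i -> dotv gi' (row l G) = 0.
Proof.
by move=> lj li; rewrite dotvBl dotvZl dot_gj'_other // o 1?eq_sym // mulr0 subr0.
Qed.

Lemma swap_decomp : gs_decomp (xrow i j A) swap_coef_mx swap_gs_mx.
Proof.
have [AE HL oG nG] := dA.
have B0 : B != 0 by rewrite gt_eqF.
have rowj : row j swap_gs_mx = gj' by rewrite rowK eqxx.
have rowi : row i swap_gs_mx = gi' by rewrite rowK (negPf neq_ij) eqxx.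
have rowl l : l != j -> l != i -> row l swap_gs_mx = row l G.
  by move=> lj li; rewrite rowK (negPf lj) (negPf li).
split.
- apply/row_matrixP => k; rewrite row_mul mulmx_sum_row.
  have -> : row k (xrow i j A) = row (tperm i j k) A by apply/rowP => c; rewrite !mxE.
  rewrite AE row_mul mulmx_sum_row.
  rewrite [LHS](bigD1 j) //= [X in _ + X = _](bigD1 i) //=.
  rewrite [RHS](bigD1 j) //= [X in _ = _ + X](bigD1 i) //=.
  rewrite rowi rowj !mxE !eqxx (negPf neq_ij) !addrA; congr (_ + _); last first.
    apply: eq_bigr => l /andP[lj li].
    by rewrite rowl // !mxE (negPf lj) (negPf li).
  set k' := tperm i j k; rewrite /gi' /gj'.
  by apply/rowP => c; rewrite !mxE; field.
- move=> k l kl; rewrite mxE.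
  set k' := tperm i j k.
  have [lj|lj] := eqVneq l j.
    subst l; have [kj|kj] := eqVneq k j.
      by rewrite /k' kj tpermR HL // eqxx -/mu mulr1n; field.
    have ltkj : (k < j)%N by rewrite ltn_neqAle kl andbT.
    have ki : i != k by rewrite -val_eqE /= ij gtn_eqF // ltnS ltnW.
    rewrite /k' tpermD // 1?eq_sym // !HL ?(ltnW ltkj) //; last by rewrite ij ltnW // ltnS ltnW.
    by rewrite (negPf kj) eq_sym (negPf ki) !mul0r addr0.
  have [li|li] := eqVneq l i.
    subst l; have [ki|ki] := eqVneq k i.
      by rewrite /k' ki tpermL !HL ?ij // eqxx eq_sym (negPf neq_ij) mulr0 subr0.
    have [kj|kj] := eqVneq k j.
      by rewrite /k' kj tpermR (HL i i) // eqxx mulr1 subrr.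
    have ltkj : (k < j)%N.
      by rewrite ltn_neqAle kj /= -ltnS -ij ltn_neqAle ki.
    rewrite /k' tpermD 1?eq_sym // !HL //; last exact: ltnW.
    by rewrite (negPf kj) (negPf ki) mulr0 subr0.
  have [ki|ki] := eqVneq k i.
    rewrite /k' ki tpermL HL; last by rewrite (leq_trans _ kl) // ki ij.
    by rewrite ![_ == l]eq_sym (negPf lj) (negPf li).
  have [kj|kj] := eqVneq k j.
    rewrite /k' kj tpermR HL; first by rewrite ![_ == l]eq_sym (negPf lj) (negPf li).
    by rewrite ij ltn_neqAle -kj kl andbT kj eq_sym.
  by rewrite /k' tpermD ?(eq_sym _ k) // HL.
- move=> k l; have [->|kj] := eqVneq k j; last have [->|ki] := eqVneq k i.
  + have [->|lj] := eqVneq l j; first by [].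
    have [->|li] := eqVneq l i; first by rewrite rowi rowj dot_gj'_gi'.
    by rewrite rowj rowl // dot_gj'_other.
  + have [->|lj] := eqVneq l j; first by rewrite rowi rowj dotvC dot_gj'_gi'.
    have [->|li] := eqVneq l i; first by [].
    by rewrite rowi rowl // dot_gi'_other.
  + rewrite (rowl k) //; have [->|lj] := eqVneq l j.
      by rewrite rowj dotvC dot_gj'_other.
    have [->|li] := eqVneq l i; first by rewrite rowi dotvC dot_gi'_other.
    by rewrite rowl //; apply: oG.
- move=> l; have [->|lj] := eqVneq l j.
    by rewrite rowj norm_gj' gt_eqF // mulr_gt0.
  have [->|li] := eqVneq l i; first by rewrite rowi norm_gi' gt_eqF // divr_gt0.
  by rewrite rowl.
Qed.

(** The squared norms at [j] and [i] become [B * N j] and [N i / B]; their exponents [n - j] and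
    [n - i] differ by one, so a single factor [B] survives. *)
Lemma gram_prod_swap : gram_prod (xrow i j A) = B * gram_prod A.
Proof.
rewrite (gram_prod_decomp swap_decomp) (gram_prod_decomp dA).
rewrite (bigD1 j) // (bigD1 i) //= [in RHS](bigD1 j) // [in RHS](bigD1 i) //= !mulrA.
congr (_ * _); last first.
  by apply: eq_bigr => l /andP[lj li]; rewrite rowK (negPf lj) (negPf li).
rewrite !rowK eqxx (negPf neq_ij) eqxx norm_gj' norm_gi' -/(N i) -/(N j).
have -> : (n - j = (n - i).+1)%N by rewrite ij subnSK // -ij ltnW.
rewrite expr_div_n exprMn [in LHS]exprS.
by field; rewrite expf_neq0 // gt_eqF.
Qed.

End Swap.

End GramSchmidtDecomposition.

(** * Evaluation of the parametric Gram-Schmidt process *)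

Definition Qt_eval_mx t n m (A : 'M[Qt]_(n, m)) : 'M[rat]_(n, m) :=
  map_mx (fun x => Qt_eval x t) A.

Lemma eventually_matrix n m (A B : nat -> 'M[rat]_(n, m)) :
  (forall i j, eventually (fun t => A t i j = B t i j)) -> eventually (fun t => A t = B t).
Proof.
move=> H; have := eventually_forall (fun i => eventually_forall (H i)).
by move=> H'; apply: eventually_sub H' _ => t E; apply/matrixP => i j.
Qed.

Lemma Qt_eval_mxM n m p (A : 'M[Qt]_(n, m)) (B : 'M[Qt]_(m, p)) :
  eventually (fun t => Qt_eval_mx t (A *m B) = Qt_eval_mx t A *m Qt_eval_mx t B).
Proof.
apply: eventually_matrix => i j.
have H1 := Qt_eval_sum (index_enum 'I_m) (fun k => A i k * B k j).
have H2 := eventually_forall (fun k => Qt_evalM (A i k) (B k j)).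
apply: (eventually_sub2 H1 H2) => t E1 E2; rewrite !mxE E1.
by apply: eq_bigr => k _; rewrite E2 !mxE.
Qed.

Lemma Qt_eval_mxD n m (A B : 'M[Qt]_(n, m)) :
  eventually (fun t => Qt_eval_mx t (A + B) = Qt_eval_mx t A + Qt_eval_mx t B).
Proof.
apply: eventually_matrix => i j.
by apply: eventually_sub (Qt_evalD (A i j) (B i j)) _ => t; rewrite !mxE.
Qed.

Lemma Qt_eval_mxN n m (A : 'M[Qt]_(n, m)) :
  eventually (fun t => Qt_eval_mx t (- A) = - Qt_eval_mx t A).
Proof.
apply: eventually_matrix => i j.
by apply: eventually_sub (Qt_evalN (A i j)) _ => t; rewrite !mxE.
Qed.

Lemma Qt_eval_mxZ n m a (A : 'M[Qt]_(n, m)) :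
  eventually (fun t => Qt_eval_mx t (a *: A) = Qt_eval a t *: Qt_eval_mx t A).
Proof.
apply: eventually_matrix => i j.
by apply: eventually_sub (Qt_evalM a (A i j)) _ => t; rewrite !mxE.
Qed.

Lemma Qt_eval_mx0 n m : eventually (fun t => Qt_eval_mx t (0 : 'M[Qt]_(n, m)) = 0).
Proof.
by apply: eventually_matrix => i j; apply: eventually_sub Qt_eval0 _ => t; rewrite !mxE.
Qed.

Lemma Qt_eval_dotv m (u v : 'rV[Qt]_m) :
  eventually (fun t => Qt_eval (dotv u v) t = dotv (Qt_eval_mx t u) (Qt_eval_mx t v)).
Proof.
have H1 := Qt_eval_sum (index_enum 'I_m) (fun k => u 0 k * v 0 k).
have H2 := eventually_forall (fun k => Qt_evalM (u 0 k) (v 0 k)).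
apply: (eventually_sub2 H1 H2) => t -> E2.
by apply: eq_bigr => k _; rewrite E2 !mxE.
Qed.

Lemma Qt_eval_projection m (v : 'rV[Qt]_m) (us : seq 'rV[Qt]_m) :
  eventually (fun t =>
    Qt_eval_mx t (\sum_(u <- us) (dotv v u / dotv u u) *: u) =
    \sum_(u <- [seq Qt_eval_mx t u | u <- us]) (dotv (Qt_eval_mx t v) u / dotv u u) *: u).
Proof.
elim: us => [|u us IH].
  by apply: eventually_sub (Qt_eval_mx0 1 m) _ => t; rewrite /= !big_nil.
rewrite big_cons; set a := dotv v u / dotv u u; set s := \sum_(w <- us) _.
have H1 := eventually_and (Qt_eval_mxD (a *: u) s) (Qt_eval_mxZ a u).
have H2 := eventually_and (Qt_evalM (dotv v u) (dotv u u)^-1) (Qt_evalV (dotv u u)).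
have H3 := eventually_and (Qt_eval_dotv v u) (Qt_eval_dotv u u).
apply: (eventually_sub2 (eventually_and IH H1) (eventually_and H2 H3)).
move=> t [IHt [-> ->]] [[E2 E3] [E4 E5]].
by rewrite /= big_cons IHt /a E2 E3 E4 E5.
Qed.

(** The process performs finitely many field operations on fixed elements of [Qt], each respected by
    evaluation from some [t] on. *)
Lemma Qt_eval_gs_seq m (vs : seq 'rV[Qt]_m) :
  eventually (fun t => [seq Qt_eval_mx t u | u <- gs_seq vs] =
                       gs_seq [seq Qt_eval_mx t u | u <- vs]).
Proof.
elim/last_ind: vs => [|vs v IH]; first by exists 0%N.
set s := \sum_(u <- gs_seq vs) (dotv v u / dotv u u) *: u.
have H := eventually_and (Qt_eval_mxD v (- s)) (Qt_eval_mxN s).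
apply: (eventually_sub2 (eventually_and IH H) (Qt_eval_projection v (gs_seq vs))).
move=> t [IHt [E1 E2]] E3.
rewrite map_rcons !gs_seq_rcons /gs_step map_rcons IHt -/s E1 E2 E3.
by rewrite IHt.
Qed.

Section EvaluatedGramSchmidt.
Variables n m : nat.
Implicit Type h : 'M[{poly int}]_(n, m).

Definition eval_rat h t : 'M[rat]_(n, m) := map_mx intr (eval_mx h t).

Lemma Qt_eval_Qt_mx h : eventually (fun t => Qt_eval_mx t (Qt_mx h) = eval_rat h t).
Proof.
apply: eventually_matrix => i j.
by apply: eventually_sub (Qt_evalC (map_poly intr (h i j))) _ => t; rewrite !mxE horner_intr.
Qed.

Lemma Qt_eval_gram_schmidt h :
  eventually (fun t => Qt_eval_mx t (gram_schmidt (Qt_mx h)) = gram_schmidt (eval_rat h t)).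
Proof.
have H := Qt_eval_gs_seq [seq row j (Qt_mx h) | j <- enum 'I_n].
apply: (eventually_sub2 H (Qt_eval_Qt_mx h)) => t E1 E2.
apply/row_matrixP => i; rewrite rowK.
have -> : row i (Qt_eval_mx t (gram_schmidt (Qt_mx h))) =
    Qt_eval_mx t (nth 0 (gs_seq [seq row j (Qt_mx h) | j <- enum 'I_n]) i).
  by rewrite /Qt_eval_mx -map_row rowK.
rewrite -(nth_map 0 0 (Qt_eval_mx t (m := m))); last first.
  by rewrite size_gs_seq size_map size_enum_ord.
rewrite E1 -map_comp; congr (nth 0 (gs_seq _) i); apply: eq_map => j /=.
by rewrite -E2 /Qt_eval_mx map_row.
Qed.

Lemma gs_vec_atE h : eventually (fun t => forall i,
  gs_vec_at h i t = row i (gram_schmidt (eval_rat h t))).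
Proof.
apply: eventually_sub (Qt_eval_gram_schmidt h) _ => t <- i.
by rewrite /gs_vec_at -map_row.
Qed.

Lemma gs_coef_atE h : eventually (fun t => forall i j,
  gs_coef_at h i j t = gs_coef (eval_rat h t) i j).
Proof.
apply: eventually_forall => i; apply: eventually_forall => j.
rewrite /gs_coef_at /gs_coef; set G := gram_schmidt (Qt_mx h).
set d := dotv (row i _) _; set d' := dotv (row j G) _.
have H1 := eventually_and (Qt_evalM d d'^-1) (Qt_evalV d').
have H2 := eventually_and (Qt_eval_dotv (row i (Qt_mx h)) (row j G))
                          (Qt_eval_dotv (row j G) (row j G)).
have H3 := eventually_and (Qt_eval_gram_schmidt h) (Qt_eval_Qt_mx h).
apply: (eventually_sub2 (eventually_and H1 H2) H3).
move=> t [[-> ->] [-> ->]] [<- <-].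
by rewrite /Qt_eval_mx !map_row.
Qed.

Lemma gs_coef_germ h i j : rational_germ (fun t => gs_coef (eval_rat h t) i j).
Proof.
exists (gs_coef (Qt_mx h) i j); apply: eventually_sub (gs_coef_atE h) _ => t E.
by rewrite -E.
Qed.

Lemma gs_norm_germ h i : rational_germ (fun t => norm2 (row i (gram_schmidt (eval_rat h t)))).
Proof.
set G := gram_schmidt (Qt_mx h); exists (dotv (row i G) (row i G)).
apply: (eventually_sub2 (Qt_eval_dotv (row i G) (row i G)) (Qt_eval_gram_schmidt h)).
by move=> t -> <-; rewrite /Qt_eval_mx map_row.
Qed.

(** A right inverse over [Qt] evaluates to a right inverse for large [t]. Conversely, the
    coefficients of a linear relation over [Qt] vanish at all large [t], hence in [Qt]. *)
Lemma row_free_Qt_mx h :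
  row_free (Qt_mx h) <-> eventually (fun t => row_free (eval_rat h t)).
Proof.
split=> [/row_freeP[B AB]|Hh].
  have H := Qt_eval_mxM (Qt_mx h) B.
  have H1 : eventually (fun t => Qt_eval_mx t (1%:M : 'M[Qt]_n) = 1%:M).
    apply: eventually_matrix => i j.
    apply: (eventually_sub2 Qt_eval0 Qt_eval1) => t E0 E1; rewrite !mxE.
    by case: (i == j).
  apply: (eventually_sub2 (eventually_and H H1) (Qt_eval_Qt_mx h)) => t [].
  by rewrite AB => -> + E; rewrite E => E1; apply/row_freeP; exists (Qt_eval_mx t B).
apply: inj_row_free => v vh; apply/rowP => k; rewrite mxE; apply: Qt_eval_eq0.
have H := eventually_and (Qt_eval_mxM v (Qt_mx h)) (Qt_eval_mx0 1 m).
apply: (eventually_sub2 (eventually_and H Hh) (Qt_eval_Qt_mx h)) => t [[]].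
rewrite vh => -> E0 fh Eh; move: E0; rewrite Eh => /eqP.
by rewrite mulmx_free_eq0 // => /eqP/rowP/(_ k); rewrite !mxE.
Qed.

End EvaluatedGramSchmidt.

(** * Splitting into residue classes *)

Section Splitting.
Variables n m : nat.
Implicit Types (h : 'M[{poly int}]_(n, m)) (Phi Psi : 'M[{poly int}]_(n, m) -> Prop).

Definition affine_mx k s h := map_mx (comp_poly (affine_poly int k s)) h.

Lemma affine_mx10 h : affine_mx 1 0 h = h.
Proof.
apply/matrixP => i j; rewrite mxE /affine_poly scale1r addr0.
exact: comp_polyXr.
Qed.

Lemma eval_affine_mx k s h t : eval_mx (affine_mx k s h) t = eval_mx h (k * t + s).
Proof. by apply/matrixP => i j; rewrite !mxE horner_comp_affine. Qed.

Lemma eval_rat_affine_mx k s h t : eval_rat (affine_mx k s h) t = eval_rat h (k * t + s).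
Proof. by rewrite /eval_rat eval_affine_mx. Qed.

Lemma gram_prod_affine_mx k s h :
  gram_prod (affine_mx k s h) = gram_prod h \Po affine_poly int k s.
Proof. exact: gram_prod_map. Qed.

Lemma eval_mx_map h (t : nat) : eval_mx h t = map_mx (horner_eval (t%:R : int)) h.
Proof. by apply/matrixP => i j; rewrite !mxE. Qed.

Lemma gram_prod_eval_rat h (t : nat) :
  gram_prod (eval_rat h t) = ((gram_prod h).[t%:R])%:~R.
Proof. by rewrite /eval_rat gram_prod_map eval_mx_map gram_prod_map. Qed.

(** [U] may depend on [t] in any way: it only has to preserve the lattice. *)
Definition refines k s h h' := eventually (fun t =>
  exists2 U : 'M[int]_n, U \in unitmx & eval_mx h' t = U *m eval_mx h (k * t + s)).

Lemma refines_refl h : refines 1 0 h h.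
Proof.
by exists 0%N => t _; exists 1%:M; [exact: unitmx1 | rewrite mul1mx mul1n addn0].
Qed.

Lemma refines_affine k s j r h h' : (0 < j)%N ->
  refines k s h h' -> refines (k * j) (k * r + s) h (affine_mx j r h').
Proof.
move=> j0 H; apply: eventually_sub (eventually_affine r j0 H) _ => t [U uU E].
by exists U => //; rewrite eval_affine_mx E mulnDr mulnA addnA.
Qed.

Lemma refines_trans k s j r h h' h'' : (0 < j)%N ->
  refines k s h h' -> refines j r h' h'' -> refines (k * j) (k * r + s) h h''.
Proof.
move=> j0 H H'; apply: eventually_sub2 (eventually_affine r j0 H) H' _.
move=> t [U uU E] [V uV ->]; exists (V *m U); first by rewrite unitmx_mul uV.
by rewrite E mulmxA mulnDr mulnA addnA.
Qed.

(* With [b] set, the period is not allowed to grow. *)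
Definition splits (b : bool) h Phi := exists M : nat,
  [/\ (0 < M)%N, b -> M = 1%N &
      forall r, (r < M)%N -> exists2 h', refines M r h h' & Phi h'].

(** Allows classes with different periods to be refined to a common one. With [b] set, only the
    identity substitution remains. *)
Definition affine_stable (b : bool) Phi := forall k s h, (0 < k)%N -> (s < k)%N ->
  (b -> k = 1%N) -> Phi h -> Phi (affine_mx k s h).

Lemma splits_ret b h h' Phi : refines 1 0 h h' -> Phi h' -> splits b h Phi.
Proof.
by move=> hh' Ph; exists 1%N; split=> // r; rewrite ltnS leqn0 => /eqP ->; exists h'.
Qed.

(** Each class [r] modulo [M] is split further with its own period [N r]; the product [K] serves all
    of them. A class modulo [M * K] determines [r0] modulo [M], then a class of the quotient [e]
    modulo [N r0]; the rest is a substitution of slope [K / N r0]. *)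
Lemma splits_bind (b c : bool) h Phi Psi : (b -> c) -> affine_stable b Psi ->
  splits c h Phi -> (forall h', Phi h' -> splits b h' Psi) -> splits b h Psi.
Proof.
move=> bc stP [M [M0 M1 HM]] HP.
have /fin_all_exists[N HN] (r : 'I_M) : exists N : nat,
    [/\ (0 < N)%N, b -> N = 1%N & forall s, (s < N)%N ->
      exists2 h', refines (M * N) (M * s + r) h h' & Psi h'].
  have [h' hh' /HP[N [N0 N1 H]]] := HM r (ltn_ord r); exists N; split=> // s /H[h'' h2 P2].
  by exists h'' => //; apply: refines_trans h2.
pose K := (\prod_(r < M) N r)%N.
have K0 : (0 < K)%N by apply: prodn_gt0 => r; have [] := HN r.
exists (M * K)%N; split=> [|bt|r rMK]; first by rewrite muln_gt0 M0.
  rewrite M1 ?mul1n; last exact: bc.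
  by apply: big1 => r _; have [_ -> //] := HN r.
have rM : (r %% M < M)%N by rewrite ltn_mod.
pose r0 := Ordinal rM; have [N0 N1 H] := HN r0; set e := (r %/ M)%N.
have dK : (K = N r0 * (K %/ N r0))%N.
  by rewrite mulnC divnK // /K (bigD1 r0) //= dvdn_mulr.
set k := (K %/ N r0)%N in dK.
have k0 : (0 < k)%N by move: K0; rewrite dK muln_gt0 => /andP[].
have eK : (e < K)%N by rewrite ltn_divLR // mulnC.
have [h' hh' Ph'] := H (e %% N r0)%N (ltn_pmod _ N0).
have rE : (r = M * N r0 * (e %/ N r0) + (M * (e %% N r0) + r0))%N.
  rewrite addnA -mulnA -mulnDr [(N r0 * _)%N]mulnC -divn_eq.
  by rewrite mulnC -divn_eq.
exists (affine_mx k (e %/ N r0) h').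
  by rewrite dK mulnA {1}rE; apply: refines_affine.
apply: stP => //; first by rewrite ltn_divLR // mulnC -dK.
move=> bt; rewrite /k N1 // divn1.
by apply: big1 => r1 _; have [_ -> //] := HN r1.
Qed.

End Splitting.

(** * Size reduction *)

(** For [l < i] the operation is unitriangular, so the orthogonal vectors do not change and the
    coefficient matrix undergoes the same row operation. *)
Lemma gs_row_sub (F : realFieldType) n m (A : 'M[F]_(n, m)) (i l : 'I_n) x :
  row_free A -> (l < i)%N -> let A' := (1%:M - x *: delta_mx i l) *m A in
  [/\ row_free A', gram_prod A' = gram_prod A &
      forall a c : 'I_n, (c < a)%N ->
        gs_coef A' a c = gs_coef A a c - (a == i)%:R * x * gs_coef_mx A l c].
Proof.
move=> fA li; set U := 1%:M - _ => A'.
have tU : unitriangular U.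
  move=> a b ab; rewrite !mxE; case: (a =P i) => [ai|_]; last by rewrite mulr0 subr0.
  case: (b =P l) => [bl|_]; last by rewrite mulr0 subr0.
  by move: ab; rewrite ai bl leqNgt li.
have dA := gs_decomp_gram_schmidt fA; have dA' := gs_decomp_mul dA tU.
split.
- by rewrite /row_free mxrankMfree // -/(row_free U) row_free_unit unitriangular_unit.
- by rewrite (gram_prod_decomp dA') (gram_prod_decomp dA).
move=> a c ca; have [_ ->] // := gs_decomp_unique dA'.
rewrite mulmxBl mul1mx -scalemxAl !mxE ca; congr (_ - _).
rewrite (bigD1 l) //= !mxE !eqxx andbT big1 ?addr0 => [|k kl].
  by rewrite mulrCA mulrA.
by rewrite !mxE (negPf kl) andbF mul0r.
Qed.

Section SizeReduction.
Variables n m : nat.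
Implicit Type h : 'M[{poly int}]_(n, m).

Definition eventually_free h := eventually (fun t => row_free (eval_rat h t)).

Definition bounded_coefs h := forall i l : 'I_n, (l < i)%N ->
  eventually_bounded (fun t => gs_coef (eval_rat h t) i l).

Lemma bounded_coef_mx h i l : bounded_coefs h ->
  eventually_bounded (fun t => gs_coef_mx (eval_rat h t) i l).
Proof.
move=> bh; have [li|li] := ltnP l i.
  by apply: eventually_bounded_ext (bh _ _ li); exists 0%N => t _; rewrite mxE li.
apply: eventually_bounded_ext (eventually_bounded_cst (i == l)%:R).
by exists 0%N => t _; rewrite mxE ltnNge li.
Qed.

(* The coefficients are treated row by row, from right to left in each row:
   reducing at [(i, l)] only affects the coefficients [(i, c)] with [c <= l]. *)
Definition rank_pair (i l : 'I_n) := (i * n + (n.-1 - l))%N.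

Lemma rank_pair_inj i l a c : rank_pair i l = rank_pair a c -> i = a /\ l = c.
Proof.
rewrite /rank_pair; have := ltn_ord l; have := ltn_ord c => cn ln E.
have ia : i = a :> nat by nia.
by split; apply: val_inj => //=; move: E; rewrite ia; lia.
Qed.

Lemma rank_pair_lt i l : (rank_pair i l < n * n)%N.
Proof. rewrite /rank_pair; have := ltn_ord i; have := ltn_ord l; nia. Qed.

Definition size_reduced_upto k h := eventually (fun t => forall i l : 'I_n,
  (l < i)%N -> (rank_pair i l < k)%N -> `|gs_coef (eval_rat h t) i l| <= 2^-1).

(** A substitution preserves the degree of the Gram product but not the polynomial itself, so
    equality with [D] is kept only when [b] forbids splitting. *)
Definition partially_reduced (b : bool) (D : {poly int}) k h :=
  [/\ eventually_free h, size_reduced_upto k h, size (gram_prod h) = size D,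
      b -> gram_prod h = D & b -> bounded_coefs h].

Lemma partially_reduced_affine b D k : affine_stable b (partially_reduced b D k).
Proof.
move=> j s h j0 sj jb [fh rh sh Dh bh]; split.
- apply: eventually_sub (eventually_affine s j0 fh) _ => t.
  by rewrite eval_rat_affine_mx.
- apply: eventually_sub (eventually_affine s j0 rh) _ => t.
  by rewrite eval_rat_affine_mx.
- by rewrite gram_prod_affine_mx size_comp_poly2 // size_affine_poly.
- move=> bt; move: sj; rewrite jb // ltnS leqn0 => /eqP ->.
  by rewrite affine_mx10 Dh.
- move=> bt; move: sj; rewrite jb // ltnS leqn0 => /eqP ->.
  by rewrite affine_mx10; apply: bh.
Qed.

Definition row_sub_mx (i l : 'I_n) (q : {poly int}) h :=
  (1%:M - q *: delta_mx i l) *m h.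

Lemma eval_row_sub_mx i l q h (t : nat) :
  eval_mx (row_sub_mx i l q h) t = (1%:M - q.[t%:R] *: delta_mx i l) *m eval_mx h t.
Proof.
rewrite !eval_mx_map /row_sub_mx map_mxM map_mxB map_mxZ map_delta_mx map_mx1.
by rewrite /= /horner_eval.
Qed.

Lemma eval_rat_row_sub_mx i l q h (t : nat) :
  eval_rat (row_sub_mx i l q h) t =
  (1%:M - (q.[t%:R])%:~R *: delta_mx i l) *m eval_rat h t.
Proof.
by rewrite /eval_rat eval_row_sub_mx map_mxM map_mxB map_mxZ map_delta_mx map_mx1.
Qed.

Lemma refines_row_sub_mx (i l : 'I_n) q k s h : (l < i)%N ->
  refines k s h (row_sub_mx i l q (affine_mx k s h)).
Proof.
move=> li; exists 0%N => t _; exists (1%:M - q.[t%:R] *: delta_mx i l); last first.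
  by rewrite eval_row_sub_mx eval_affine_mx.
(* As [l != i], [delta_mx i l] squares to 0 and the inverse only changes a sign. *)
apply: (proj1 (mulmx1_unit (B := 1%:M + q.[t%:R] *: delta_mx i l) _)).
rewrite mulmxDr mulmx1 mulmxBl mul1mx -scalemxAl -scalemxAr mul_delta_mx_0; last first.
  by rewrite -val_eqE /= ltn_eqF.
by rewrite !scaler0 subr0 subrK.
Qed.

Lemma size_reduce_step b D k h :
  partially_reduced b D k h -> splits b h (partially_reduced b D k.+1).
Proof.
move=> [fh rh sh Dh bh].
(* Not every [k] is the rank of a pair below the diagonal; the others require no work. *)
have [[[i l] /= [li kE]]|nk] :=
    pselect (exists p : 'I_n * 'I_n, (p.2 < p.1)%N /\ rank_pair p.1 p.2 = k); last first.
  apply: splits_ret (refines_refl h) _; split=> //.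
  apply: eventually_sub rh _ => t H i l li.
  rewrite ltnS leq_eqVlt => /orP[/eqP ilk|]; last exact: H.
  by case: nk; exists (i, l).
have [M [M0 M1 HM]] := round_germ (gs_coef_germ h i l).
have Mb : b -> M = 1%N by move=> bt; apply: M1; apply: bh.
exists M; split=> // r rM; have [q Hq] := HM r.
exists (row_sub_mx i l q (affine_mx M r h)); first exact: refines_row_sub_mx.
set h' := row_sub_mx _ _ _ _.
have H0 : eventually (fun t => row_free (eval_rat h (M * t + r))) by apply: eventually_affine fh.
have H1 : eventually (fun t => [/\ row_free (eval_rat h' t),
    gram_prod (eval_rat h' t) = gram_prod (eval_rat h (M * t + r)) &
    forall a c : 'I_n, (c < a)%N -> gs_coef (eval_rat h' t) a c =
      gs_coef (eval_rat h (M * t + r)) a c -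
      (a == i)%:R * (q.[t%:R])%:~R * gs_coef_mx (eval_rat h (M * t + r)) l c]).
  apply: eventually_sub H0 _ => t fA.
  by rewrite eval_rat_row_sub_mx eval_rat_affine_mx; apply: gs_row_sub.
have DE : gram_prod h' = gram_prod h \Po affine_poly int M r.
  apply: eventually_horner_int_inj; apply: eventually_sub H1 _ => t [_ E _].
  move: E; rewrite !gram_prod_eval_rat horner_comp_affine => /eqP.
  by rewrite eqr_int => /eqP.
split.
- by apply: eventually_sub H1 _ => t [].
- have H2 := eventually_affine r M0 rh.
  apply: (eventually_sub2 (eventually_and H1 H2) Hq) => t [[_ _ E] R] Q a c ca.
  rewrite ltnS leq_eqVlt -{1}kE => /orP[/eqP/rank_pair_inj[ai cl]|ack].
    rewrite E // ai cl eqxx mul1r gs_coef_mx_unitriangular // eqxx mulr1.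
    exact: Q.
  (* A smaller rank in row [i] means [l < c], where row [l] of the unitriangular coefficient matrix
     is 0: reduced entries stay reduced. *)
  rewrite E //; have [ai|ai] := eqVneq a i; last by rewrite !mul0r subr0; apply: R.
  rewrite gs_coef_mx_unitriangular; last first.
    move: ack; rewrite -kE ai /rank_pair; have := ltn_ord l; have := ltn_ord c; lia.
  have lc : l != c by apply: contraTneq ack => lc; rewrite -kE ai lc ltnn.
  by rewrite (negPf lc) mulr0 subr0; apply: R.
- by rewrite DE size_comp_poly2 ?size_affine_poly.
- move=> bt; move: (Mb bt) rM => M_1; rewrite DE M_1 ltnS leqn0 => /eqP ->.
  by rewrite /affine_poly scale1r addr0 comp_polyXr Dh.
- move=> bt; have {}bh := bh bt.
  (* [q] stays within 1/2 of a bounded coefficient. *)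
  have bq : eventually_bounded (fun t => (q.[t%:R])%:~R).
    have b2 : eventually_bounded
        (fun t => gs_coef (eval_rat h (M * t + r)) i l - (q.[t%:R])%:~R) by exists 2^-1.
    apply: eventually_bounded_ext
      (eventually_boundedB (eventually_bounded_affine r M0 (bh _ _ li)) b2).
    by exists 0%N => t _; rewrite subKr.
  move=> a c ca; apply: eventually_bounded_ext (eventually_boundedB
    (eventually_bounded_affine r M0 (bh _ _ ca))
    (eventually_boundedM (eventually_boundedM (eventually_bounded_cst (a == i)%:R) bq)
      (eventually_bounded_affine r M0 (bounded_coef_mx l c bh)))).
  by apply: eventually_sub H1 _ => t [_ _ ->].
Qed.

Lemma size_reduce (b : bool) h : eventually_free h -> (b -> bounded_coefs h) ->
  splits b h (partially_reduced b (gram_prod h) (n * n)).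
Proof.
move=> fh bh; elim: (n * n)%N => [|k IH].
  apply: splits_ret (refines_refl h) _; split=> //.
  by exists 0%N.
apply: (splits_bind (c := b)) IH _ => //; first exact: partially_reduced_affine.
exact: size_reduce_step.
Qed.

End SizeReduction.

(** * The parametric LLL algorithm *)

Section ParametricLLL.
Variables (R : realType) (delta : R) (n m : nat).
Hypotheses (delta_gt0 : 0 < delta) (delta_lt1 : delta < 1).
Implicit Type h : 'M[{poly int}]_(n, m).

(** For [i = j.+1] this is also the factor [B] by which the swap multiplies the Gram product. *)
Definition lovasz_ratio (A : 'M[rat]_(n, m)) (i j : 'I_n) : rat :=
  norm2 (row i (gram_schmidt A)) / norm2 (row j (gram_schmidt A)) + gs_coef A i j ^+ 2.

Lemma lovasz_ratio_germ h i j : rational_germ (fun t => lovasz_ratio (eval_rat h t) i j).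
Proof.
apply: rational_germD; last by apply: rational_germM; apply: gs_coef_germ.
by apply: rational_germM; [|apply: rational_germV]; apply: gs_norm_germ.
Qed.

Definition LLL_reduced (A : 'M[rat]_(n, m)) :=
  (forall i j : 'I_n, (j < i)%N -> `|gs_coef A i j| <= 2^-1) /\
  (forall i j : 'I_n, i = j.+1 :> nat -> delta <= ratr (lovasz_ratio A i j)).

Definition eventually_LLL h :=
  eventually_free h /\ eventually (fun t => LLL_reduced (eval_rat h t)).

Lemma eventually_LLL_affine b : affine_stable b eventually_LLL.
Proof.
move=> k s h k0 _ _ [fh rh]; split.
  apply: eventually_sub (eventually_affine s k0 fh) _ => t.
  by rewrite eval_rat_affine_mx.
apply: eventually_sub (eventually_affine s k0 rh) _ => t.
by rewrite eval_rat_affine_mx.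
Qed.

Lemma eventually_LLL_reducedP h :
  eventually_LLL h -> eventually_LLL_reduced delta h.
Proof.
move=> [fh rh]; split; first exact/row_free_Qt_mx.
apply: (eventually_sub2 (eventually_and (gs_vec_atE h) (gs_coef_atE h)) rh).
move=> t [E1 E2] [R1 R2]; split=> i j ij; first by rewrite E2; apply: R1.
by rewrite E2 !E1; apply: R2.
Qed.

Lemma eval_rat_xrow i j h t : eval_rat (xrow i j h) t = xrow i j (eval_rat h t).
Proof. by rewrite /eval_rat /eval_mx !map_xrow. Qed.

Lemma refines_xrow i j h : refines 1 0 h (xrow i j h).
Proof.
exists 0%N => t _; exists (tperm_mx i j); first exact: unitmx_perm.
by rewrite -xrowE /eval_mx map_xrow mul1n addn0.
Qed.

Section Swap.
Variables (h : 'M[{poly int}]_(n, m)) (i j : 'I_n).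
Hypotheses (fh : eventually_free h) (ij : i = j.+1 :> nat).

Lemma eventually_free_xrow : eventually_free (xrow i j h).
Proof.
apply: eventually_sub fh _ => t fA; rewrite eval_rat_xrow xrowE.
by rewrite /row_free mxrankMfree // -/(row_free _) row_free_unit unitmx_perm.
Qed.

Lemma lovasz_ratioE (A : 'M[rat]_(n, m)) :
  lovasz_ratio A i j = norm2 (row i (gram_schmidt A)) / norm2 (row j (gram_schmidt A)) +
                       gs_coef_mx A i j ^+ 2.
Proof. by rewrite /lovasz_ratio mxE ij ltnSn. Qed.

Lemma gram_prod_xrow : eventually (fun t => 
  ((gram_prod (xrow i j h)).[t%:R])%:~R =
  lovasz_ratio (eval_rat h t) i j * ((gram_prod h).[t%:R])%:~R).
Proof.
apply: eventually_sub fh _ => t fA; rewrite -!gram_prod_eval_rat eval_rat_xrow.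
by rewrite lovasz_ratioE; apply: gram_prod_swap; [exact: gs_decomp_gram_schmidt |].
Qed.

Lemma bounded_coefs_xrow c : 0 < c ->
  eventually (fun t => c <= lovasz_ratio (eval_rat h t) i j) ->
  bounded_coefs h -> bounded_coefs (xrow i j h).
Proof.
move=> c0 Hc bh a l la.
pose L t := gs_coef_mx (eval_rat h t); pose B t := lovasz_ratio (eval_rat h t) i j.
have bL a' l' : eventually_bounded (fun t => L t a' l') by apply: bounded_coef_mx.
have bB : eventually_bounded (fun t => (B t)^-1).
  exists c^-1; apply: eventually_sub Hc _ => t cB.
  have B0 := lt_le_trans c0 cB.
  by rewrite ger0_norm ?invr_ge0 ?(ltW B0) // lef_pV2 ?posrE.
have bmB : eventually_bounded (fun t => L t i j / B t) by apply: eventually_boundedM.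
have H : eventually (fun t =>
    swap_coef_mx (L t) (gram_schmidt (eval_rat h t)) i j a l =
    gs_coef (eval_rat (xrow i j h) t) a l).
  apply: eventually_sub fh _ => t fA.
  have := swap_decomp (gs_decomp_gram_schmidt fA) ij.
  by move=> /gs_decomp_unique[_ /(_ _ _ la) <-]; rewrite eval_rat_xrow.
apply: eventually_bounded_ext H _; set k' := tperm i j a.
have [lj|lj] := eqVneq l j.
  apply: (@eventually_bounded_ext
    (fun t => L t k' i * (1 - L t i j * (L t i j / B t)) + L t k' j * (L t i j / B t))).
    by exists 0%N => t _; rewrite [RHS]mxE lj eqxx -/k' /B lovasz_ratioE /norm2 expr2 -mulrA.
  apply: eventually_boundedD; last exact: eventually_boundedM.
  apply: eventually_boundedM => //; apply: eventually_boundedB; first exact: eventually_bounded_cst.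
  exact: eventually_boundedM.
have [li|li] := eqVneq l i.
  apply: (@eventually_bounded_ext (fun t => L t k' j - L t i j * L t k' i)).
    by exists 0%N => t _; rewrite [RHS]mxE (negPf lj) li eqxx.
  by apply: eventually_boundedB; last exact: eventually_boundedM.
apply: (@eventually_bounded_ext (fun t => L t k' l)) => //.
by exists 0%N => t _; rewrite [RHS]mxE (negPf lj) (negPf li).
Qed.

End Swap.

Lemma gram_prod_eventually_gt0 h : eventually_free h ->
  eventually (fun t => 0 < (gram_prod h).[t%:R]).
Proof.
move=> fh; apply: eventually_sub fh _ => t /gram_prod_gt0.
by rewrite gram_prod_eval_rat ltr0z.
Qed.

Lemma lead_coef_gram_prod_gt0 h : eventually_free h -> 0 < lead_coef (gram_prod h).
Proof.
move=> /gram_prod_eventually_gt0 H; rewrite -(ltr0z rat) -lead_coef_map_intr.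
apply: lead_coef_gt0; apply: eventually_sub H _ => t.
by rewrite horner_intr ltr0z.
Qed.

(** One phase of constant degree, by induction on the leading coefficient. Size reduction runs with
    [b = true], so [D] is literally unchanged by it. After a drop in degree the hypothesis on
    smaller sizes takes over; it asks for no boundedness. *)
Lemma LLL_bounded d :
  (forall h, eventually_free h -> (size (gram_prod h) < d)%N ->
     splits false h eventually_LLL) ->
  forall h, eventually_free h -> bounded_coefs h -> size (gram_prod h) = d ->
     splits false h eventually_LLL.
Proof.
move=> IHd h; have [c] := ubnP `|lead_coef (gram_prod h)|%N.
elim: c h => // c IHc h; rewrite ltnS => le_c fh bh dh.
have st := @eventually_LLL_affine false.
apply: (splits_bind (c := true)) (size_reduce (b := true) fh (fun=> bh)) _ => //.
move=> h1 [f1 r1 _ /(_ isT) D1 /(_ isT) b1].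
have [all_ok|] := pselect (forall p : 'I_n * 'I_n, eventually (fun t =>
    p.1 = p.2.+1 :> nat -> delta <= ratr (lovasz_ratio (eval_rat h1 t) p.1 p.2))).
  apply: splits_ret (refines_refl h1) _; split=> //.
  apply: (eventually_sub2 r1 (eventually_forall all_ok)) => t R1 R2.
  split=> [i l li|i j ij]; first by apply: R1 => //; apply: rank_pair_lt.
  exact: (R2 (i, j)).
move=> /existsNP[[i j] /=] nij.
have [ij|ij] := eqVneq (i : nat) j.+1; last first.
  by case: nij; exists 0%N => t _ ij'; rewrite ij' eqxx in ij.
have [ge|lt] := rational_germ_cmp delta (lovasz_ratio_germ h1 i j).
  by case: nij; apply: eventually_sub ge _.
pose h2 := xrow i j h1.
apply: (splits_bind (c := false) (Phi := eq h2)) => //.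
  by apply: splits_ret (refines_xrow i j h1) _.
move=> _ <-.
have f2 : eventually_free h2 := eventually_free_xrow i j f1.
pose P1 := map_poly (intr : int -> R) (gram_prod h1).
pose P2 := map_poly (intr : int -> R) (gram_prod h2).
have le12 : eventually (fun t => 0 < P2.[t%:R] <= (delta *: P1).[t%:R]).
  have H := eventually_and (gram_prod_eventually_gt0 f1) (gram_prod_eventually_gt0 f2).
  apply: (eventually_sub2 (eventually_and (gram_prod_xrow f1 ij) lt) H).
  move=> t [E B] [D1t D2t]; rewrite hornerZ !horner_intr ltr0z D2t /=.
  rewrite -(ratr_int R _) E rmorphM /= ratr_int ler_wpM2r ?ler0z ?(ltW D1t) //.
  exact: ltW.
have szZ : size (delta *: P1) = d by rewrite size_scale ?gt_eqF // size_map_intr D1.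
have := size_le_of_eventually le12; rewrite szZ size_map_intr leq_eqVlt.
case/orP => [/eqP sz2|]; last exact: IHd.
have l1 := lead_coef_gram_prod_gt0 f1; have l2 := lead_coef_gram_prod_gt0 f2.
have lc2 : lead_coef (gram_prod h2) < lead_coef (gram_prod h1).
  have le12' : eventually (fun t => P2.[t%:R] <= (delta *: P1).[t%:R]).
    by apply: eventually_sub le12 _ => t /andP[].
  have sz12 : size P2 = size (delta *: P1) by rewrite szZ size_map_intr.
  have := lead_coef_le_of_eventually sz12 le12'.
  rewrite lead_coefZ !lead_coef_map_intr => H; rewrite -(ltr_int R).
  by apply: le_lt_trans H _; rewrite gtr_pMl // ltr0z.
apply: IHc => //; first by move: le_c lc2 l2; rewrite -D1; lia.
(* The degree was kept, so the quotient [B] of the two Gram products is at least some [e > 0]; [e]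
   has to be rational to bound rational coefficients. *)
pose Q1 := map_poly (intr : int -> rat) (gram_prod h1).
pose Q2 := map_poly (intr : int -> rat) (gram_prod h2).
have [||| e e0 He] := @eventually_ge_of_same_size _ Q1 Q2.
- by rewrite !size_map_intr sz2 D1.
- by rewrite lead_coef_map_intr ltr0z.
- by rewrite lead_coef_map_intr ltr0z.
apply: (bounded_coefs_xrow f1 ij e0) => //.
apply: (eventually_sub2 (eventually_and (gram_prod_xrow f1 ij) He)
         (gram_prod_eventually_gt0 f1)) => t [E].
by rewrite !horner_intr E => + D1t; rewrite ler_pM2r // ltr0z.
Qed.

(** Induction on the degree. The first size reduction may split; it keeps the degree and leaves
    coefficients bounded by 1/2, which is what a phase of constant degree starts from on each
    class. *)
Theorem parametric_LLL h : eventually_free h -> splits false h eventually_LLL.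
Proof.
have [d] := ubnP (size (gram_prod h)); elim: d h => // d IHd h.
rewrite ltnS => le_d fh.
have st := @eventually_LLL_affine false.
apply: (splits_bind (c := false)) (size_reduce (b := false) fh _) _ => //.
move=> h1 [f1 r1 s1 _ _].
apply: (@LLL_bounded (size (gram_prod h))) => //.
  by move=> h2 f2 lt2; apply: IHd => //; apply: leq_trans le_d.
move=> i l li; exists 2^-1; apply: eventually_sub r1 _ => t; apply=> //.
exact: rank_pair_lt.
Qed.

End ParametricLLL.

(** * Integer lattices and gluing of residue classes *)

Section IntegerLattices.
Variables n m : nat.
Implicit Type A : 'M[int]_(n, m).

Lemma sum_row_int A (c : 'I_n -> int) :
  \sum_(i < n) row i A *~ c i = (\row_i c i) *m A.
Proof.
rewrite mulmx_sum_row; apply: eq_bigr => i _.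
by rewrite mxE -scaler_int intz.
Qed.

Lemma int_spanP A v : int_span A v <-> exists c : 'rV[int]_n, v = c *m A.
Proof.
have nthE (i : 'I_n) : nth 0 [tuple row i A | i < n] i = row i A.
  by rewrite -tnth_nth tnth_mktuple.
split=> [[a ->]|[c ->]].
  exists (\row_i a i); rewrite -sum_row_int; apply: eq_bigr => i _.
  by rewrite nthE.
exists [ffun i => c 0 i]; rewrite (eq_bigr (fun i => row i A *~ c 0 i)).
  by rewrite sum_row_int; congr (_ *m _); apply/rowP => i; rewrite mxE.
by move=> i _; rewrite nthE ffunE.
Qed.

Lemma lattice_basis_unimodular A (U : 'M[int]_n) : U \in unitmx ->
  row_free (map_mx (intr : int -> rat) (U *m A)) ->
  lattice_basis (int_span A) (U *m A).
Proof.
move=> uU fB; split=> [v|c].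
  split=> /int_spanP[c ->]; apply/int_spanP.
    by exists (c *m invmx U); rewrite mulmxA mulmxKV.
  by exists (c *m U); rewrite mulmxA.
rewrite sum_row_int => cB i.
have /eqP : map_mx (intr : int -> rat) (\row_i c i) *m map_mx intr (U *m A) = 0.
  by rewrite -map_mxM cB map_mx0.
rewrite mulmx_free_eq0 // => /eqP/rowP/(_ i); rewrite !mxE => /eqP.
by rewrite intr_eq0 => /eqP.
Qed.

End IntegerLattices.

Theorem theorem1p4 (R : realType) (delta : R)
    (delta_gt : 4^-1 < delta) (delta_lt : delta < 1)
    (n m : nat) (f : 'M[{poly int}]_(n, m)) (f_free : row_free (Qt_mx f)) :
  exists g : nat -> 'M[int]_(n, m),
    [/\ EQP_coords g,
        eventually (fun t => lattice_basis (int_span (eval_mx f t)) (g t)) &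
        eventually_LLL_reduced_EQP delta g].
Proof.
have d0 : 0 < delta by apply: lt_trans delta_gt; rewrite invr_gt0 ltr0n.
have ff : eventually_free f by apply/row_free_Qt_mx.
have [M [M0 _ HM]] := parametric_LLL d0 delta_lt ff.
have /fin_all_exists[h Hh] (r : 'I_M) : exists h : 'M[{poly int}]_(n, m),
    refines M r f h /\ eventually_LLL delta h.
  by have [h fh Lh] := HM r (ltn_ord r); exists h.
pose res t := Ordinal (ltn_pmod t M0).
pose g t := eval_mx (h (res t)) (t %/ M).
have gE (r : 'I_M) t : g (M * t + r)%N = eval_mx (h r) t.
  rewrite /g mulnC divnMDl // divn_small ?ltn_ord // addn0.
  by congr (eval_mx (h _) _); apply: val_inj; rewrite /= modnMDl modn_small.
have gEQP : EQP_coords_mod M g.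
  move=> i k; split=> //.
  (* On the class of [r] the quotient [t %/ M] is the polynomial [(t - r) / M], so rational
     coefficients appear although [h r] is integral. *)
  exists (fun r : 'I_M => map_poly intr (h r i k) \Po (M%:R^-1 *: ('X - r%:R%:P))).
  exists 0%N => t _ r tr.
  have tE : t = (M * (t %/ M) + r)%N by rewrite {1}(divn_eq t M) mulnC tr modn_small.
  rewrite {1}tE gE mxE horner_comp !hornerE {2}tE natrD natrM addrK mulKf.
    by rewrite horner_intr.
  by rewrite pnatr_eq0 -lt0n.
have to_all (P : nat -> Prop) :
    (forall r : 'I_M, eventually (fun t => P (M * t + r)%N)) -> eventually P.
  move=> /eventually_forall[N HN]; exists (M * N)%N => t Nt.
  have := HN (t %/ M)%N _ (res t); rewrite /= mulnC -divn_eq; apply.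
  by rewrite leq_divRL // mulnC.
exists g; split.
- by move=> i k; exists M.
- apply: to_all => r; have [fr [er _]] := Hh r.
  apply: (eventually_sub2 fr er) => t [U uU E]; rewrite /eval_rat gE E.
  exact: lattice_basis_unimodular.
- exists M; split=> // r; exists (h r); split; first by exists 0%N => t _; rewrite gE.
  by apply: eventually_LLL_reducedP; have [] := Hh r.
Qed.
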